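(* Let $d\ge 3$ be a natural number and put $D=2^d$. Let $X,Y\in\mathbf{R}$ with $\lfloor Y\rfloor>d$. Let $f\colon(X,X+Y]\to\mathbf{R}$ be a real function with continuous derivatives up to order $d$, and assume $0<\lambda\le f^{(d)}(x)\le\Lambda$ for all $X<x\le X+Y$. Then \[ \Bigl|\frac{1}{Y}\sum_{X<n\le X+Y}e(f(n))\Bigr|\le \max\Bigl\{A_d\Bigl(\frac{\Lambda}{\lambda Y}\Bigr)^{2/D},\ B_d\Bigl(\frac{\Lambda^2}{\lambda}\Bigr)^{1/(D-2)},\ C_d(\lambda Y^d)^{-2/D}\Bigr\}, \] where \[ A_d=B\sqrt{2}\,(d-2)^{2/D},\quad B_d=B\Bigl(\frac{3^4}{2^3}\Bigl(\frac23\Bigr)^{2d}2^{D/4}A^2B^{-2}\Bigr)^{1/(D-2)},\quad C_d=B\Bigl(\frac{AD}{B}\Bigr)^{4/D}(d-2)^{2(d-2)/D}. \]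
   Context: $e(x)=e^{2\pi i x}$; the sum runs over integers $n$. The constants are $A=\frac{2}{\sqrt{\pi}}\bigl(1+\sqrt{1+3\pi/8}\bigr)=2.7936\ldots$ and $B=2+2\sqrt2=4.8284\ldots$. *)

(* Defs.v *)
From Stdlib Require Import Reals Lra ZArith List.
From Coquelicot Require Import Coquelicot.
Open Scope R_scope.

Definition e (x : R) : C := (cos (2 * PI * x), sin (2 * PI * x)).

(* The integers n with X < n <= X + Y, in increasing order.
   [up X] is the least integer > X; [Int_part r] is floor r. *)
Definition int_range (X Y : R) : list Z :=
  map (fun k : nat => (up X + Z.of_nat k)%Z)
      (seq 0 (Z.to_nat (Int_part (X + Y) - up X + 1))).

Definition exp_sum (f : R -> R) (X Y : R) : C :=
  fold_right (fun n acc => Cplus (e (f (IZR n))) acc) (RtoC 0) (int_range X Y).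

(* g' is the derivative of g at x relative to the set I (one-sided at endpoints) *)
Definition has_deriv_within (I : R -> Prop) (g g' : R -> R) (x : R) : Prop :=
  forall eps, 0 < eps -> exists delta, 0 < delta /\
    forall y, I y -> Rabs (y - x) < delta ->
      Rabs (g y - g x - g' x * (y - x)) <= eps * Rabs (y - x).

Definition cont_within (I : R -> Prop) (g : R -> R) (x : R) : Prop :=
  forall eps, 0 < eps -> exists delta, 0 < delta /\
    forall y, I y -> Rabs (y - x) < delta -> Rabs (g y - g x) < eps.

(* F 0 = f, F 1 = f', ..., F d = f^(d): f has continuous derivatives up to
   order d on I, F k being the k-th derivative. *)
Definition Cd_on (d : nat) (I : R -> Prop) (F : nat -> R -> R) : Prop :=
  (forall k x, (k < d)%nat -> I x -> has_deriv_within I (F k) (F (S k)) x) /\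
  (forall k x, (k <= d)%nat -> I x -> cont_within I (F k) x).

Definition cA : R := 2 / sqrt PI * (1 + sqrt (1 + 3 * PI / 8)).
Definition cB : R := 2 + 2 * sqrt 2.

Definition Dd (d : nat) : R := 2 ^ d.

Definition A_d (d : nat) : R :=
  cB * sqrt 2 * Rpower (INR d - 2) (2 / Dd d).
Definition B_d (d : nat) : R :=
  cB * Rpower (3 ^ 4 / 2 ^ 3 * (2 / 3) ^ (2 * d) * Rpower 2 (Dd d / 4)
               * cA ^ 2 * / cB ^ 2) (1 / (Dd d - 2)).
Definition C_d (d : nat) : R :=
  cB * Rpower (cA * Dd d / cB) (4 / Dd d)
     * Rpower (INR d - 2) (2 * (INR d - 2) / Dd d).

(* Main.v *)
Require Import Defs.
From Stdlib Require Import Reals ZArith List.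
From Coquelicot Require Import Coquelicot.
From Stdlib Require Import Lra Lia.
Open Scope R_scope.

(** The function is only seen through the values [s i = f (up X + i)], whose
    [d]-th differences lie in [[lam, Lam]] by the mean value theorem. With
    [k = d - 2] and [K = 2 ^ k], van der Corput's inequality is applied [k]
    times, with shifts bounded by reals [x_1, ..., x_k], and the sums that
    remain are bounded by the second difference test (Kuzmin-Landau on the
    pieces where the first difference is away from the integers). Writing the
    right-hand side as [B * G], the identity [B ^ 2 = 4 + 4 * B] shows that it
    suffices to have [x_j >= 2 / G ^ (2 ^ j)] and the final average at most
    [B * G ^ K]. That average depends on the [x_j] only through their product
    [P]: it is at most [a * sqrt P + b / sqrt P] with explicit [a] and [b]. The
    three terms of the maximum are what makes a value of [P] admissible: the
    last one gives [b / sqrt P <= B * G ^ K / 2] at the largest [P = Y ^ k], the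
    middle one [a * sqrt P <= B * G ^ K / 2] at the smallest [P], and the first
    one compatibility of these two conditions on [P]. *)

(** * Finite sums *)

Fixpoint rsum (u : nat -> R) (n : nat) : R :=
  match n with O => 0 | S m => rsum u m + u m end.

Fixpoint csum (u : nat -> C) (n : nat) : C :=
  match n with O => RtoC 0 | S m => Cplus (csum u m) (u m) end.

Definition esum (s : nat -> R) (n : nat) : C := csum (fun i => e (s i)) n.

Lemma rsum_ext (u v : nat -> R) (n : nat) :
  (forall i, (i < n)%nat -> u i = v i) -> rsum u n = rsum v n.
Proof.
  induction n as [|n IH]; intros H; simpl; [reflexivity|].
  rewrite IH, H by (intros; try apply H; lia). reflexivity.
Qed.

Lemma rsum_le (u v : nat -> R) (n : nat) :
  (forall i, (i < n)%nat -> u i <= v i) -> rsum u n <= rsum v n.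
Proof.
  induction n as [|n IH]; intros H; simpl; [lra|].
  apply Rplus_le_compat; [apply IH; intros; apply H | apply H]; lia.
Qed.

Lemma rsum_plus (u v : nat -> R) (n : nat) :
  rsum (fun i => u i + v i) n = rsum u n + rsum v n.
Proof. induction n as [|n IH]; simpl; [lra|]. rewrite IH; lra. Qed.

Lemma rsum_scal (c : R) (u : nat -> R) (n : nat) :
  rsum (fun i => c * u i) n = c * rsum u n.
Proof. induction n as [|n IH]; simpl; [lra|]. rewrite IH; lra. Qed.

Lemma rsum_const (c : R) (n : nat) : rsum (fun _ => c) n = INR n * c.
Proof. induction n as [|n IH]; [simpl; lra|]. rewrite S_INR; simpl. lra. Qed.

Lemma rsum_cat (u : nat -> R) (m n : nat) :
  rsum u (m + n) = rsum u m + rsum (fun i => u (m + i)%nat) n.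
Proof.
  induction n as [|n IH]; [rewrite Nat.add_0_r; simpl; lra|].
  rewrite Nat.add_succ_r; simpl. rewrite IH; lra.
Qed.

Lemma rsum_exchange (u : nat -> nat -> R) (m n : nat) :
  rsum (fun i => rsum (u i) n) m = rsum (fun j => rsum (fun i => u i j) m) n.
Proof.
  induction m as [|m IH]; simpl; [rewrite rsum_const; lra|].
  rewrite IH, <- rsum_plus. reflexivity.
Qed.

Lemma rsum_nonneg (u : nat -> R) (n : nat) :
  (forall i, (i < n)%nat -> 0 <= u i) -> 0 <= rsum u n.
Proof.
  intros H. replace 0 with (rsum (fun _ => 0) n) by (rewrite rsum_const; lra).
  now apply rsum_le.
Qed.

Lemma rsum_le_len (u : nat -> R) (m n : nat) :
  (m <= n)%nat -> (forall i, 0 <= u i) -> rsum u m <= rsum u n.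
Proof.
  intros H Hu. replace n with (m + (n - m))%nat by lia. rewrite rsum_cat.
  assert (0 <= rsum (fun i => u (m + i)%nat) (n - m)) by now apply rsum_nonneg.
  lra.
Qed.

Lemma rsum_rev (u : nat -> R) (n : nat) :
  rsum (fun i => u (n - i)%nat) n = rsum (fun i => u (S i)) n.
Proof.
  induction n as [|n IH]; [reflexivity|].
  change (S n) with (1 + n)%nat at 2. rewrite rsum_cat; simpl rsum at 1.
  rewrite (rsum_ext _ (fun i => u (n - i)%nat))
    by (intros; f_equal; lia).
  rewrite IH; simpl. lra.
Qed.

Lemma rsum_window (u : nat -> R) (a n M : nat) :
  (a + n <= M)%nat ->
  (forall i, (i < a)%nat \/ (a + n <= i)%nat -> u i = 0) ->
  rsum u M = rsum (fun i => u (a + i)%nat) n.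
Proof.
  intros HM H0. replace M with (a + n + (M - (a + n)))%nat by lia.
  rewrite !rsum_cat.
  rewrite (rsum_ext u (fun _ => 0) a) by (intros; apply H0; lia).
  rewrite (rsum_ext (fun i => u (a + n + i)%nat) (fun _ => 0))
    by (intros; apply H0; lia).
  rewrite !rsum_const; lra.
Qed.

(** Induction on [n]: the new cross term is absorbed by summing [(u i - u n) ^ 2 >= 0] over
    [i < n]. *)
Lemma rsum_cauchy_schwarz (u : nat -> R) (n : nat) :
  rsum u n ^ 2 <= INR n * rsum (fun i => u i ^ 2) n.
Proof.
  induction n as [|n IH]; [simpl; lra|].
  rewrite S_INR; cbn [rsum]. set (a := rsum u n) in *.
  set (b := rsum (fun i => u i ^ 2) n) in *.
  assert (Hab : 2 * (a * u n) <= b + INR n * u n ^ 2).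
  { unfold a, b. rewrite <- rsum_const, <- rsum_plus.
    rewrite (Rmult_comm _ (u n)), <- !rsum_scal. apply rsum_le; intros i _.
    generalize (pow2_ge_0 (u i - u n)); lra. }
  lra.
Qed.

Lemma csum_cat (u : nat -> C) (m n : nat) :
  csum u (m + n) = Cplus (csum u m) (csum (fun i => u (m + i)%nat) n).
Proof.
  induction n as [|n IH]; [rewrite Nat.add_0_r; simpl; ring|].
  rewrite Nat.add_succ_r; simpl. rewrite IH; ring.
Qed.

Lemma csum_ext (u v : nat -> C) (n : nat) :
  (forall i, (i < n)%nat -> u i = v i) -> csum u n = csum v n.
Proof.
  induction n as [|n IH]; intros H; simpl; [reflexivity|].
  rewrite IH, H by (intros; try apply H; lia). reflexivity.
Qed.

Lemma csum_parts (u : nat -> C) (n : nat) :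
  csum u n = (rsum (fun i => fst (u i)) n, rsum (fun i => snd (u i)) n).
Proof. induction n as [|n IH]; simpl; [reflexivity|]. rewrite IH; reflexivity. Qed.

Lemma e_plus (x y : R) : e (x + y) = Cmult (e x) (e y).
Proof.
  unfold e, Cmult; simpl. rewrite Rmult_plus_distr_l, cos_plus, sin_plus.
  f_equal; ring.
Qed.

Lemma Cmod_e (x : R) : Cmod (e x) = 1.
Proof.
  unfold Cmod, e; simpl fst; simpl snd.
  replace (_ + _) with 1; [apply sqrt_1|].
  generalize (sin2_cos2 (2 * PI * x)); unfold Rsqr; lra.
Qed.

Lemma e_IZR (z : Z) : e (IZR z) = RtoC 1.
Proof.
  assert (H : sin (IZR z * PI) = 0) by (apply sin_eq_0_1; now exists z).
  unfold e, RtoC. replace (2 * PI * IZR z) with (2 * (IZR z * PI)) by ring.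
  rewrite cos_2a_sin, sin_2a, H. f_equal; ring.
Qed.

Lemma esum_trivial (s : nat -> R) (n : nat) : Cmod (esum s n) <= INR n.
Proof.
  induction n as [|n IH].
  - unfold esum; simpl. rewrite Cmod_0; lra.
  - rewrite S_INR. unfold esum in *; simpl.
    eapply Rle_trans; [apply Cmod_triangle|]. rewrite Cmod_e; lra.
Qed.

(** * The Kuzmin-Landau inequality *)

(** The function sin t - t cos t vanishes at 0 and has derivative t sin t, nonnegative up to PI. *)
Lemma x_cos_le_sin (x : R) : 0 <= x -> x <= PI -> x * cos x <= sin x.
Proof.
  intros H0 H1. destruct (Rle_lt_or_eq_dec _ _ H0) as [Hx|<-].
  2: { rewrite sin_0; lra. }
  destruct (MVT_gen (fun t => sin t - t * cos t) 0 x (fun t => t * sin t))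
    as [c [Hc E]].
  - intros t _. auto_derive; [trivial|ring].
  - intros t _. apply derivable_continuous_pt, ex_derive_Reals_0. auto_derive. trivial.
  - rewrite Rmin_left, Rmax_right in Hc by lra.
    rewrite sin_0 in E.
    assert (0 <= sin c) by (apply sin_ge_0; lra).
    assert (0 <= c * sin c * (x - 0)).
    { apply Rmult_le_pos; [apply Rmult_le_pos|]; lra. }
    lra.
Qed.

(* (1 + cos u) / sin u = cot (u / 2) <= 2 / u. *)
Lemma half_cot_bound (u w : R) :
  0 < w -> w <= u -> u < PI -> (1 + cos u) / sin u <= 2 / w.
Proof.
  intros Hw Hu Hpi.
  assert (Hs : 0 < sin (u / 2)) by (apply sin_gt_0; lra).
  assert (Hc : 0 < cos (u / 2)) by (apply cos_gt_0; lra).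
  replace u with (2 * (u / 2)) at 1 2 by field.
  rewrite sin_2a, cos_2a_cos.
  replace ((1 + (2 * cos (u / 2) * cos (u / 2) - 1)) /
           (2 * sin (u / 2) * cos (u / 2)))
    with (cos (u / 2) / sin (u / 2)) by (field; lra).
  assert (H := x_cos_le_sin (u / 2) ltac:(lra) ltac:(lra)).
  apply Rle_trans with (2 / u).
  - apply Rmult_le_reg_r with (sin (u / 2) * u); [nra|].
    field_simplify; [|lra|lra]. lra.
  - unfold Rdiv. apply Rmult_le_compat_l; [lra|]. apply Rinv_le_contravar; lra.
Qed.

(* With u = PI * x, this is 1 / (1 - e x), where e x = exp (2 PI i x). *)
Definition kl_coef (u : R) : C := (/ 2, cos u / sin u / 2).

(** With c for the coefficient, this is c (1 - e x) = 1 in the form that merges a term of the sum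
    with the next one in the summation by parts. *)
Lemma kl_coef_eq (x : R) : sin (PI * x) <> 0 ->
  Cplus (RtoC 1) (Cmult (e x) (kl_coef (PI * x))) = kl_coef (PI * x).
Proof.
  intros H. unfold e, kl_coef, Cplus, Cmult, RtoC; simpl.
  replace (2 * PI * x) with (2 * (PI * x)) by ring.
  rewrite sin_2a, cos_2a_sin.
  assert (E := sin2_cos2 (PI * x)); unfold Rsqr in E.
  set (a := sin (PI * x)) in *; set (b := cos (PI * x)) in *.
  f_equal; [|field; trivial].
  replace (2 * a * b * (b / a / 2)) with (b * b) by (field; trivial). lra.
Qed.

Lemma Cmod_kl_coef (u : R) : 0 < sin u -> Cmod (kl_coef u) = / sin u / 2.
Proof.
  intros H. unfold Cmod, kl_coef; simpl fst; simpl snd.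
  assert (E := sin2_cos2 u); unfold Rsqr in E.
  assert (Hi : 0 < / sin u) by now apply Rinv_0_lt_compat.
  rewrite <- (sqrt_pow2 (/ sin u / 2)) by lra.
  f_equal. field_simplify; try lra.
  replace (cos u ^ 2) with (1 - sin u ^ 2) by lra. field. lra.
Qed.

Lemma Cmod_one_minus_kl_coef (u : R) : 0 < sin u ->
  Cmod (Cminus (RtoC 1) (kl_coef u)) = / sin u / 2.
Proof.
  intros H. rewrite <- Cmod_kl_coef by trivial. unfold Cmod, kl_coef; simpl.
  f_equal. field. lra.
Qed.

(** The coefficients lie on the vertical line of abscissa 1/2 and cot decreases on (0, PI), so
    distances along a monotone sequence of arguments telescope. *)
Lemma Cmod_kl_coef_minus (u v : R) :
  0 < u -> u <= v -> v < PI ->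
  Cmod (Cminus (kl_coef v) (kl_coef u)) = (cos u / sin u - cos v / sin v) / 2.
Proof.
  intros Hu Huv Hv.
  assert (Su : 0 < sin u) by (apply sin_gt_0; lra).
  assert (Sv : 0 < sin v) by (apply sin_gt_0; lra).
  assert (H : 0 <= cos u / sin u - cos v / sin v).
  { replace (cos u / sin u - cos v / sin v) with (sin (v - u) / (sin u * sin v))
      by (rewrite sin_minus; field; lra).
    apply Rdiv_le_0_compat; [apply sin_ge_0; lra | nra]. }
  unfold Cmod, kl_coef; simpl fst; simpl snd.
  rewrite <- (sqrt_pow2 ((cos u / sin u - cos v / sin v) / 2)) by lra.
  f_equal. field. lra.
Qed.

(** Summation by parts. With c_n the coefficient of the n-th difference, the partial sum completed
    by e(s_(n+1)) c_n starts as e(s_0) c_0 and grows by e(s_(n+1)) (c_(n+1) - c_n) at each step; the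
    moduli telescope because the differences are monotone. *)
Lemma kuzmin_landau_aux (s : nat -> R) (n : nat) :
  (forall i, (i <= n)%nat -> 0 < s (S i) - s i < 1) ->
  (forall i, (i < n)%nat -> s (S i) - s i <= s (S (S i)) - s (S i)) ->
  Cmod (Cplus (esum s (S n))
          (Cmult (e (s (S n))) (kl_coef (PI * (s (S n) - s n))))) <=
  (/ sin (PI * (s 1%nat - s 0%nat))
   + cos (PI * (s 1%nat - s 0%nat)) / sin (PI * (s 1%nat - s 0%nat))
   - cos (PI * (s (S n) - s n)) / sin (PI * (s (S n) - s n))) / 2.
Proof.
  assert (P := PI_RGT_0).
  intros Hd Hm.
  assert (Hrec : forall i, (i <= n)%nat ->
    Cplus (e (s i)) (Cmult (e (s (S i))) (kl_coef (PI * (s (S i) - s i)))) =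
    Cmult (e (s i)) (kl_coef (PI * (s (S i) - s i)))).
  { intros i Hi. specialize (Hd i Hi).
    rewrite <- kl_coef_eq at 2
      by (apply Rgt_not_eq, sin_gt_0; nra).
    replace (s (S i)) with (s i + (s (S i) - s i)) at 1 by ring.
    rewrite e_plus. ring. }
  induction n as [|n IH].
  - unfold esum; simpl csum. rewrite Cplus_0_l, Hrec by lia.
    rewrite Cmod_mult, Cmod_e, Cmod_kl_coef
      by (apply sin_gt_0; specialize (Hd 0%nat ltac:(lia)); nra).
    lra.
  - specialize (IH ltac:(intros; apply Hd; lia) ltac:(intros; apply Hm; lia)
                   ltac:(intros; apply Hrec; lia)).
    change (esum s (S (S n))) with (Cplus (esum s (S n)) (e (s (S n)))).
    rewrite <- Cplus_assoc, Hrec by lia.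
    set (c1 := kl_coef (PI * (s (S (S n)) - s (S n)))).
    set (c0 := kl_coef (PI * (s (S n) - s n))) in *.
    replace (Cplus (esum s (S n)) (Cmult (e (s (S n))) c1)) with
      (Cplus (Cplus (esum s (S n)) (Cmult (e (s (S n))) c0))
             (Cmult (e (s (S n))) (Cminus c1 c0))) by ring.
    eapply Rle_trans; [apply Cmod_triangle|].
    rewrite Cmod_mult, Cmod_e. unfold c1, c0 at 2.
    assert (D0 := Hd n ltac:(lia)). assert (D1 := Hd (S n) ltac:(lia)).
    assert (D := Hm n ltac:(lia)).
    rewrite Cmod_kl_coef_minus by nra. lra.
Qed.

Lemma kuzmin_landau (s : nat -> R) (n : nat) (th : R) :
  0 < th -> th <= 1 / 2 ->
  (forall i, (S i < n)%nat -> th <= s (S i) - s i <= 1 - th) ->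
  (forall i, (S (S i) < n)%nat -> s (S i) - s i <= s (S (S i)) - s (S i)) ->
  Cmod (esum s n) <= 2 / (PI * th).
Proof.
  assert (P := PI_RGT_0). assert (P4 := PI_4).
  intros H0 H1 Hd Hm.
  assert (Hw : 0 < PI * th) by nra.
  assert (Hone : 1 <= 2 / (PI * th)).
  { apply Rmult_le_reg_r with (PI * th); [trivial|].
    field_simplify; [nra|lra]. }
  destruct n as [|[|n]].
  - unfold esum; simpl. rewrite Cmod_0; lra.
  - eapply Rle_trans; [apply esum_trivial|]. simpl; lra.
  - assert (K := kuzmin_landau_aux s n
      ltac:(intros i Hi; specialize (Hd i ltac:(lia)); lra)
      ltac:(intros i Hi; apply Hm; lia)).
    assert (D0 := Hd 0%nat ltac:(lia)). assert (Dn := Hd n ltac:(lia)).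
    set (u := PI * (s 1%nat - s 0%nat)) in *.
    set (v := PI * (s (S n) - s n)) in *.
    assert (Hu : PI * th <= u) by (unfold u; nra).
    assert (Hu' : u < PI) by (unfold u; nra).
    assert (Hv : PI * th <= v) by (unfold v; nra).
    assert (Hv' : PI * th <= PI - v) by (unfold v; nra).
    assert (Sv : 0 < sin v) by (apply sin_gt_0; lra).
    assert (Su : 0 < sin u) by (apply sin_gt_0; lra).
    assert (B1 := half_cot_bound u (PI * th) Hw Hu Hu').
    assert (B2 := half_cot_bound (PI - v) (PI * th) Hw Hv' ltac:(lra)).
    rewrite Rtrigo_facts.cos_pi_minus, sin_PI_x in B2.
    change (esum s (S (S n))) with (Cplus (esum s (S n)) (e (s (S n)))).
    (* The last term is split as e c + e (1 - c): the first part completes the summation by parts,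
       and |1 - c| = |c|. What remains is half of (1 + cos u) / sin u plus half of (1 - cos v) / sin
       v, each half being at most 1 / (PI th). *)
    replace (Cplus (esum s (S n)) (e (s (S n)))) with
      (Cplus (Cplus (esum s (S n)) (Cmult (e (s (S n))) (kl_coef v)))
             (Cmult (e (s (S n))) (Cminus (RtoC 1) (kl_coef v)))) by ring.
    eapply Rle_trans; [apply Cmod_triangle|].
    rewrite Cmod_mult, Cmod_e, Cmod_one_minus_kl_coef by trivial.
    replace ((1 + cos u) / sin u) with (/ sin u + cos u / sin u) in B1
      by (field; lra).
    replace ((1 + - cos v) / sin v) with (/ sin v - cos v / sin v) in B2
      by (field; lra).
    lra.
Qed.

(** * The second difference test *)

Lemma esum_cat (s : nat -> R) (m n : nat) :
  esum s (m + n) = Cplus (esum s m) (esum (fun i => s (m + i)%nat) n).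
Proof. apply csum_cat. Qed.

Lemma first_above (u : nat -> R) (t : R) (n : nat) :
  (forall i, (S i < n)%nat -> u i <= u (S i)) ->
  exists q, (q <= n)%nat /\ (forall i, (i < q)%nat -> u i < t) /\
    (forall i, (q <= i < n)%nat -> t <= u i).
Proof.
  induction n as [|n IH]; intros Hu.
  - exists 0%nat. repeat split; intros; lia.
  - destruct IH as [q [Hq [H1 H2]]]; [intros; apply Hu; lia|].
    destruct (Nat.eq_dec q n) as [->|Hne].
    + destruct (Rlt_le_dec (u n) t) as [H|H].
      * exists (S n). repeat split; intros; try lia.
        destruct (Nat.eq_dec i n) as [->|]; [trivial|apply H1; lia].
      * exists n. repeat split; intros; try lia; auto.
        now replace i with n by lia.
    + exists q. repeat split; intros; try lia; auto.
      destruct (Nat.eq_dec i n) as [->|]; [|apply H2; lia].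
      assert (t <= u (pred n)) by (apply H2; lia).
      assert (u (pred n) <= u (S (pred n))) by (apply Hu; lia).
      replace (S (pred n)) with n in * by lia. lra.
Qed.

Lemma diff_growth (u : nat -> R) (lam : R) (n i : nat) :
  (forall j, (S j < n)%nat -> lam <= u (S j) - u j) ->
  (i < n)%nat -> lam * INR i <= u i - u 0%nat.
Proof.
  intros H. induction i as [|i IH]; intros Hi; [simpl; lra|].
  specialize (IH ltac:(lia)). specialize (H i ltac:(lia)).
  rewrite S_INR. lra.
Qed.

(** Since e has period 1, first differences lying between m and m + 1 can be moved into the unit
    interval, where Kuzmin-Landau applies. *)
Lemma esum_shift_slope (s : nat -> R) (m : Z) (n : nat) :
  esum (fun i => s i - IZR m * INR i) n = esum s n.
Proof.
  unfold esum. apply csum_ext; intros i _.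
  replace (s i) with ((s i - IZR m * INR i) + IZR (m * Z.of_nat i)) at 2.
  - rewrite e_plus, e_IZR. ring.
  - rewrite mult_IZR, <- INR_IZR_INZ. ring.
Qed.

(* The differences of s cross at most M unit intervals [m - th, m + 1 - th).
   In each of them, at most 2 th / lam + 1 differences are within th of m and
   Kuzmin-Landau handles the others; the final 1 is for the last term. *)
Lemma esum_unit_intervals (lam th : R) (M : nat) :
  0 < lam -> 0 < th -> th <= 1 / 2 ->
  forall (L : nat) (s : nat -> R) (m : Z),
  (forall i, (i < L)%nat ->
     IZR m - th <= s (S i) - s i < IZR m - th + INR M) ->
  (forall i, (S i < L)%nat ->
     lam <= (s (S (S i)) - s (S i)) - (s (S i) - s i)) ->
  Cmod (esum s (S L)) <= INR M * (2 * th / lam + 1 + 2 / (PI * th)) + 1.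
Proof.
  intros Hl Ht0 Ht1. induction M as [|M IH]; intros L s m Hd Hdd.
  { destruct L as [|L].
    - eapply Rle_trans; [apply esum_trivial|]. simpl; lra.
    - specialize (Hd 0%nat ltac:(lia)). simpl in Hd. lra. }
  (* The differences reach m + th at [q] and m + 1 - th at [r']. The terms before [q] are counted
     trivially, those from [q] to [r'] go to Kuzmin-Landau, and the rest is left to the induction
     with m + 1. *)
  destruct (first_above (fun i => s (S i) - s i) (IZR m + th) L)
    as [q [Hq [Q1 Q2]]].
  { intros i Hi; specialize (Hdd i Hi); lra. }
  destruct (first_above (fun i => s (S i) - s i) (IZR m + 1 - th) L)
    as [r' [Hr [R1 R2]]].
  { intros i Hi; specialize (Hdd i Hi); lra. }
  assert (Hqr : (q <= r')%nat).
  { destruct (Nat.le_gt_cases q r') as [|Hc]; [trivial|exfalso].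
    specialize (Q1 r' Hc). specialize (R2 r' ltac:(lia)). simpl in *. lra. }
  pose (r := (r' - q)%nat).
  replace (S L) with (q + (r + S (L - r')))%nat by lia.
  rewrite !esum_cat.
  assert (Bq : Cmod (esum s q) <= 2 * th / lam + 1).
  { eapply Rle_trans; [apply esum_trivial|].
    destruct q as [|q].
    - simpl. assert (0 < 2 * th / lam) by (apply Rdiv_lt_0_compat; lra). lra.
    - assert (G := diff_growth (fun i => s (S i) - s i) lam L q
               ltac:(intros; apply Hdd; lia) ltac:(lia)).
      simpl in G.
      specialize (Q1 q ltac:(lia)). specialize (Hd 0%nat ltac:(lia)).
      simpl in Q1. rewrite S_INR.
      assert (INR q <= 2 * th / lam); [|lra].
      apply Rmult_le_reg_r with lam; [trivial|].
      unfold Rdiv. rewrite Rmult_assoc, Rinv_l by lra. lra. }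
  assert (Br : Cmod (esum (fun i => s (q + i)%nat) r) <= 2 / (PI * th)).
  { rewrite <- (esum_shift_slope _ m).
    apply kuzmin_landau; try lra; intros i Hi; rewrite !S_INR.
    - specialize (Q2 (q + i)%nat ltac:(lia)).
      specialize (R1 (q + i)%nat ltac:(lia)). simpl in *.
      rewrite Nat.add_succ_r. lra.
    - specialize (Hdd (q + i)%nat ltac:(lia)).
      rewrite !Nat.add_succ_r. lra. }
  assert (Bs : Cmod (esum (fun i => s (q + (r + i))%nat) (S (L - r'))) <=
    INR M * (2 * th / lam + 1 + 2 / (PI * th)) + 1).
  { apply (IH _ _ (m + 1)%Z); intros i Hi.
    - specialize (R2 (q + (r + i))%nat ltac:(lia)).
      specialize (Hd (q + (r + i))%nat ltac:(lia)).
      rewrite S_INR in Hd. rewrite plus_IZR, !Nat.add_succ_r.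
      simpl in *. lra.
    - specialize (Hdd (q + (r + i))%nat ltac:(lia)).
      rewrite !Nat.add_succ_r. lra. }
  rewrite S_INR.
  eapply Rle_trans; [apply Cmod_triangle|].
  eapply Rle_trans; [apply Rplus_le_compat_l, Cmod_triangle|].
  lra.
Qed.

(** This is where the value of A comes from: it yields [4 / sqrt PI + 3 / 2 * x <= cA] whenever
    [cA * x <= 1], applied to x = sqrt lam in the second difference test. *)
Lemma cA_quadratic : cA ^ 2 = 4 / sqrt PI * cA + 3 / 2.
Proof.
  assert (P := PI_RGT_0).
  assert (Hs : 0 < sqrt PI) by now apply sqrt_lt_R0.
  unfold cA. set (w := sqrt (1 + 3 * PI / 8)).
  assert (Hw : w ^ 2 = 1 + 3 * PI / 8) by (apply pow2_sqrt; lra).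
  assert (Hp : PI = sqrt PI ^ 2) by (rewrite pow2_sqrt; lra).
  replace ((2 / sqrt PI * (1 + w)) ^ 2) with (4 / PI * (1 + 2 * w + w ^ 2))
    by (rewrite Hp at 1; field; lra).
  replace (4 / sqrt PI * (2 / sqrt PI * (1 + w))) with (8 / PI * (1 + w))
    by (rewrite Hp at 1; field; lra).
  rewrite Hw. field. lra.
Qed.

Lemma cA_pos : 0 < cA.
Proof.
  assert (P := PI_RGT_0). assert (Hs : 0 < sqrt PI) by now apply sqrt_lt_R0.
  unfold cA. apply Rmult_lt_0_compat; [apply Rdiv_lt_0_compat; lra|].
  assert (H := sqrt_pos (1 + 3 * PI / 8)). lra.
Qed.

Lemma second_difference_test (s : nat -> R) (N : nat) (Y lam Lam : R) :
  1 <= Y -> INR N <= Y + 1 -> 0 < lam <= Lam ->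
  (forall i, (S (S i) < N)%nat ->
     lam <= (s (S (S i)) - s (S i)) - (s (S i) - s i) <= Lam) ->
  Cmod (esum s N) <= cA * (Lam * Y + 2) / sqrt lam.
Proof.
  intros HY HN Hl Hdd.
  assert (HA := cA_pos). assert (HQ := cA_quadratic).
  assert (P := PI_RGT_0). assert (P4 := PI_4).
  assert (Hsp : 0 < sqrt PI) by now apply sqrt_lt_R0.
  assert (Hsl : 0 < sqrt lam) by (apply sqrt_lt_R0; lra).
  assert (Hsl2 : sqrt lam ^ 2 = lam) by (apply pow2_sqrt; lra).
  assert (Hsp2 : sqrt PI ^ 2 = PI) by (apply pow2_sqrt; lra).
  assert (HA2 : 3 / 2 <= cA ^ 2).
  { assert (0 < 4 / sqrt PI) by (apply Rdiv_lt_0_compat; lra). nra. }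
  destruct (Rle_lt_dec 1 (cA * sqrt lam)) as [Hbig|Hsmall].
  { eapply Rle_trans; [apply esum_trivial|].
    eapply Rle_trans; [apply HN|].
    apply Rmult_le_reg_r with (sqrt lam); [trivial|].
    unfold Rdiv. rewrite Rmult_assoc, Rinv_l by lra.
    rewrite Rmult_1_r.
    apply Rle_trans with (cA * (lam * Y + 2));
      [|apply Rmult_le_compat_l; nra].
    set (x := sqrt lam) in *. rewrite <- Hsl2.
    assert (HxY : 0 < x * Y) by nra.
    (* [x * Y] is at most [cA * x * (x * Y)]; the remaining [x] is covered by [2 * cA] if
       [cA * x <= 2], and otherwise by a second copy of [x * Y]. *)
    destruct (Rle_lt_dec (cA * x) 2).
    - assert (x <= 2 * cA) by (apply Rmult_le_reg_l with cA; nra).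
      assert (1 * (x * Y) <= cA * x * (x * Y)) by (apply Rmult_le_compat_r; lra).
      nra.
    - assert (2 * (x * Y) <= cA * x * (x * Y)) by (apply Rmult_le_compat_r; lra).
      nra. }
  destruct (Nat.le_gt_cases N 1) as [HN1|HN1].
  { eapply Rle_trans; [apply esum_trivial|].
    apply Rle_trans with 1; [now apply (le_INR N 1)|].
    apply Rmult_le_reg_r with (sqrt lam); [trivial|].
    unfold Rdiv. rewrite Rmult_assoc, Rinv_l by lra.
    assert (sqrt lam <= 2 * cA) by (apply Rmult_le_reg_l with cA; nra).
    assert (0 <= cA * (Lam * Y)) by (apply Rmult_le_pos; nra).
    lra. }
  pose (L := pred N).
  (* This width equates the two costs 2 th / lam and 2 / (PI th) of a unit interval. *)
  pose (th := sqrt lam / sqrt PI).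
  assert (Hth0 : 0 < th) by now apply Rdiv_lt_0_compat.
  assert (Hth1 : th <= 1 / 2).
  { unfold th. assert (1 < cA) by nra.
    apply Rmult_le_reg_r with (sqrt PI); [trivial|].
    unfold Rdiv. rewrite Rmult_assoc, Rinv_l by lra.
    assert (4 / sqrt PI <= cA).
    { apply Rmult_le_reg_r with cA; [trivial|]. nra. }
    assert (4 <= cA * sqrt PI).
    { apply Rmult_le_reg_r with (/ sqrt PI); [now apply Rinv_0_lt_compat|].
      rewrite Rmult_assoc, Rinv_r by lra. lra. }
    nra. }
  pose (d0 := s 1%nat - s 0%nat).
  (* The floor of [d0 + th], so that the first difference lies in [m - th, m + 1 - th). *)
  pose (m := (up (d0 + th) - 1)%Z).
  destruct (archimed (d0 + th)) as [U1 U2].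
  assert (Hm : IZR m = IZR (up (d0 + th)) - 1) by (unfold m; now rewrite minus_IZR).
  pose (V := Lam * (INR L - 1)).
  assert (HNL : INR N = INR L + 1).
  { rewrite <- S_INR. f_equal. lia. }
  assert (HL1 : 1 <= INR L) by (apply (le_INR 1); lia).
  assert (HV : 0 <= V) by (unfold V; nra).
  destruct (archimed (V + 1)) as [W1 W2].
  (* The differences rise by at most [V] in total, so [M > V + 1] intervals contain them all, while
     [M <= V + 2]. *)
  pose (M := Z.to_nat (up (V + 1))).
  assert (HM : INR M = IZR (up (V + 1))).
  { unfold M. rewrite INR_IZR_INZ, Z2Nat.id; [trivial|].
    apply le_IZR. simpl. lra. }
  replace N with (S L) by lia.
  eapply Rle_trans.
  { apply (esum_unit_intervals lam th M ltac:(lra) Hth0 Hth1 L s m).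
    - intros i Hi.
      assert (G1 := diff_growth (fun i => s (S i) - s i) 0 L i
        ltac:(intros j Hj; specialize (Hdd j ltac:(lia)); lra) Hi).
      assert (G2 := diff_growth (fun i => - (s (S i) - s i)) (- Lam) L i
        ltac:(intros j Hj; specialize (Hdd j ltac:(lia)); lra) Hi).
      simpl in G1, G2. fold d0 in G1, G2.
      assert (INR i <= INR L - 1).
      { assert (INR (S i) <= INR L) by (apply le_INR; lia).
        rewrite S_INR in *. lra. }
      assert (Lam * INR i <= V) by (unfold V; nra).
      lra.
    - intros i Hi. apply Hdd; lia. }
  assert (E1 : 2 * th / lam = 2 / (sqrt PI * sqrt lam)).
  { unfold th. rewrite <- Hsl2 at 2. field. split; lra. }
  assert (E2 : 2 / (PI * th) = 2 / (sqrt PI * sqrt lam)).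
  { unfold th. rewrite <- Hsp2 at 1. field. split; lra. }
  rewrite E1, E2.
  set (T := 2 / (sqrt PI * sqrt lam)).
  assert (HT : 0 < T) by (apply Rdiv_lt_0_compat; nra).
  assert (HMV : INR M <= Lam * Y + 2).
  { rewrite HM. assert (V <= Lam * Y) by (unfold V; nra). lra. }
  assert (HLY : 0 <= Lam * Y) by nra.
  (* As [Lam * Y + 2 >= 2], the final 1 is at most 1/2 times this factor, which produces the 3/2 in
     the equation of A. *)
  apply Rle_trans with ((Lam * Y + 2) * (T + 1 + T) + 1); [nra|].
  assert (HTA : T + 1 + T + 1 / 2 <= cA / sqrt lam); [|unfold Rdiv in *; nra].
  apply Rmult_le_reg_r with (sqrt lam); [trivial|].
  replace (cA / sqrt lam * sqrt lam) with cA by (field; lra).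
  replace ((T + 1 + T + 1 / 2) * sqrt lam) with (4 / sqrt PI + 3 / 2 * sqrt lam)
    by (unfold T; field; lra).
  apply Rmult_le_reg_r with cA; [trivial|]. nra.
Qed.

(** * Van der Corput's inequality and its iteration *)

(** Delaying by [h] and extending by zero places all shifted copies of a sequence on one range of
    natural indices, without boundary terms. *)
Definition pad (v : nat -> R) (N h m : nat) : R :=
  if andb (h <=? m)%nat (m - h <? N)%nat then v (m - h)%nat else 0.

Lemma pad_in (v : nat -> R) (N h i : nat) :
  (i < N)%nat -> pad v N h (h + i) = v i.
Proof.
  intros Hi. unfold pad. replace (h + i - h)%nat with i by lia.
  rewrite (proj2 (Nat.leb_le h (h + i))), (proj2 (Nat.ltb_lt i N)) by lia.
  reflexivity.
Qed.

Lemma pad_out (v : nat -> R) (N h m : nat) :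
  (m < h)%nat \/ (h + N <= m)%nat -> pad v N h m = 0.
Proof.
  intros H. unfold pad.
  destruct (Nat.leb_spec h m), (Nat.ltb_spec (m - h) N); simpl; trivial; lia.
Qed.

Lemma rsum_pad (v : nat -> R) (N h M : nat) :
  (h + N <= M)%nat -> rsum (pad v N h) M = rsum v N.
Proof.
  intros H. rewrite (rsum_window _ h N) by (trivial; intros; now apply pad_out).
  apply rsum_ext; intros; now apply pad_in.
Qed.

Lemma rsum_pad_mul (v : nat -> R) (N h j M : nat) :
  (h + j + N <= M)%nat ->
  rsum (fun m => pad v N h m * pad v N (h + j) m) M =
  rsum (fun n => v (n + j)%nat * v n) (N - j).
Proof.
  intros H. rewrite (rsum_window _ (h + j) (N - j)); [|lia|].
  - apply rsum_ext; intros i Hi. rewrite pad_in by lia.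
    rewrite <- Nat.add_assoc, pad_in by lia. f_equal. f_equal. lia.
  - intros i [Hi|Hi].
    + rewrite (pad_out v N (h + j)) by lia. lra.
    + rewrite (pad_out v N h) by lia. lra.
Qed.

Definition shift_diff (h : nat) (s : nat -> R) (n : nat) : R := s (n + h)%nat - s n.

Definition re_e (s : nat -> R) (n : nat) : R := fst (e (s n)).
Definition im_e (s : nat -> R) (n : nat) : R := snd (e (s n)).

Lemma Cmod_esum_sqr (s : nat -> R) (N : nat) :
  Cmod (esum s N) ^ 2 = rsum (re_e s) N ^ 2 + rsum (im_e s) N ^ 2.
Proof.
  unfold esum. rewrite csum_parts. unfold Cmod; simpl fst; simpl snd.
  rewrite pow2_sqrt; [reflexivity|].
  apply Rplus_le_le_0_compat; apply pow2_ge_0.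
Qed.

(** The modulus of the autocorrelation of e(s n) at lag [j]; for [j >= N] the truncated length makes
    it 0. *)
Definition corr (s : nat -> R) (N j : nat) : R :=
  Cmod (esum (shift_diff j s) (N - j)).

(** By cos a cos b + sin a sin b = cos (a - b), the left side is the real part of the sum whose
    modulus is [corr s N j]. *)
Lemma pad_correlation (s : nat -> R) (N h j M : nat) :
  (h + j + N <= M)%nat ->
  rsum (fun m => pad (re_e s) N h m * pad (re_e s) N (h + j) m) M +
  rsum (fun m => pad (im_e s) N h m * pad (im_e s) N (h + j) m) M <=
  corr s N j.
Proof.
  intros H. rewrite !rsum_pad_mul, <- rsum_plus by trivial.
  eapply Rle_trans; [|apply re_le_Cmod].
  eapply Rle_trans; [|apply Rle_abs].
  unfold esum, Re. rewrite csum_parts; simpl. apply Req_le, rsum_ext; intros i _.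
  unfold re_e, im_e, shift_diff, e; simpl.
  rewrite <- cos_minus. f_equal. ring.
Qed.

(** Truncated subtraction makes [(h - h') + (h' - h)] the distance |h - h'|, so one formula serves
    both orders. *)
Lemma pad_correlation_sym (s : nat -> R) (N h h' M : nat) :
  (h + N <= M)%nat -> (h' + N <= M)%nat ->
  rsum (fun m => pad (re_e s) N h m * pad (re_e s) N h' m) M +
  rsum (fun m => pad (im_e s) N h m * pad (im_e s) N h' m) M <=
  corr s N ((h - h') + (h' - h)).
Proof.
  intros H H'. destruct (Nat.le_ge_cases h h') as [Hc|Hc].
  - replace (h - h' + (h' - h))%nat with (h' - h)%nat by lia.
    assert (D := pad_correlation s N h (h' - h) M ltac:(lia)).
    now replace (h + (h' - h))%nat with h' in D by lia.
  - replace (h - h' + (h' - h))%nat with (h - h')%nat by lia.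
    rewrite (rsum_ext _ (fun m => pad (re_e s) N h' m * pad (re_e s) N h m))
      by (intros; ring).
    rewrite (rsum_ext (fun m => pad (im_e s) N h m * _)
               (fun m => pad (im_e s) N h' m * pad (im_e s) N h m))
      by (intros; ring).
    assert (D := pad_correlation s N h' (h - h') M ltac:(lia)).
    now replace (h' + (h - h'))%nat with h in D by lia.
Qed.

Lemma rsum_square_pad (v : nat -> R) (N H M : nat) :
  rsum (fun m => rsum (fun h => pad v N h m) H ^ 2) M =
  rsum (fun h => rsum (fun h' =>
    rsum (fun m => pad v N h m * pad v N h' m) M) H) H.
Proof.
  rewrite (rsum_ext _ (fun m => rsum (fun h => rsum (fun h' =>
     pad v N h m * pad v N h' m) H) H)).
  - rewrite rsum_exchange. apply rsum_ext; intros h _. apply rsum_exchange.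
  - intros m _. set (t := rsum (fun h => pad v N h m) H).
    rewrite (rsum_ext _ (fun h => t * pad v N h m)).
    + rewrite rsum_scal. unfold t. ring.
    + intros h _. rewrite rsum_scal. unfold t. ring.
Qed.

(** Seen from [h], the distance 0 occurs once and every positive distance below [H] at most
    twice. *)
Lemma rsum_distances (r : nat -> R) (H h : nat) :
  (forall j, 0 <= r j) -> (h < H)%nat ->
  rsum (fun h' => r ((h - h') + (h' - h))%nat) H <=
  r 0%nat + 2 * rsum (fun j => r (S j)) (H - 1).
Proof.
  intros Hr Hh.
  replace H with (h + (1 + (H - 1 - h)))%nat at 1 by lia.
  rewrite !rsum_cat.
  rewrite (rsum_ext _ (fun i => r (h - i)%nat) h) by (intros; f_equal; lia).
  rewrite rsum_rev.
  rewrite (rsum_ext _ (fun i => r (S i)) (H - 1 - h)) by (intros; f_equal; lia).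
  simpl rsum at 2. replace (h - (h + 0) + (h + 0 - h))%nat with 0%nat by lia.
  assert (A1 : rsum (fun i => r (S i)) h <= rsum (fun i => r (S i)) (H - 1))
    by (apply rsum_le_len; [lia|intros; apply Hr]).
  assert (A2 : rsum (fun i => r (S i)) (H - 1 - h) <=
               rsum (fun i => r (S i)) (H - 1))
    by (apply rsum_le_len; [lia|intros; apply Hr]).
  lra.
Qed.

(** Each term appears once at each of the [H] offsets, so [H] times the sum is a sum over N + H - 1
    windows. Cauchy-Schwarz over the windows, for real and imaginary parts separately, and expansion
    of the squares leave the correlations at lags |h - h'|. *)
Lemma van_der_corput (s : nat -> R) (N H : nat) :
  (0 < H)%nat ->
  INR H * Cmod (esum s N) ^ 2 <=
  INR (N + H - 1) * (INR N + 2 * rsum (fun j => corr s N (S j)) (H - 1)).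
Proof.
  intros HH. set (M := (N + H - 1)%nat).
  assert (Hpos : 0 < INR H) by now apply lt_0_INR.
  assert (Hsum : forall v, INR H * rsum v N =
                 rsum (fun m => rsum (fun h => pad v N h m) H) M).
  { intros v. rewrite rsum_exchange, <- rsum_const. apply rsum_ext; intros h Hh.
    rewrite rsum_pad; [reflexivity|unfold M; lia]. }
  assert (Hcs : forall v, (INR H * rsum v N) ^ 2 <= INR M *
      rsum (fun h => rsum (fun h' =>
        rsum (fun m => pad v N h m * pad v N h' m) M) H) H).
  { intros v. rewrite Hsum, <- rsum_square_pad. apply rsum_cauchy_schwarz. }
  assert (C1 := Hcs (re_e s)). assert (C2 := Hcs (im_e s)).
  set (T := INR N + 2 * rsum (fun j => corr s N (S j)) (H - 1)).
  assert (HT : rsum (fun h => rsum (fun h' =>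
        rsum (fun m => pad (re_e s) N h m * pad (re_e s) N h' m) M) H) H +
      rsum (fun h => rsum (fun h' =>
        rsum (fun m => pad (im_e s) N h m * pad (im_e s) N h' m) M) H) H
      <= INR H * T).
  { rewrite <- rsum_plus, <- rsum_const. apply rsum_le; intros h Hh.
    rewrite <- rsum_plus.
    eapply Rle_trans.
    { apply rsum_le; intros h' Hh'.
      apply pad_correlation_sym; unfold M; lia. }
    eapply Rle_trans.
    { apply (rsum_distances (corr s N)); [intros; apply Cmod_ge_0|trivial]. }
    unfold T. apply Rplus_le_compat_r. unfold corr. rewrite Nat.sub_0_r.
    apply esum_trivial. }
  assert (HM : 0 <= INR M) by apply pos_INR.
  apply Rmult_le_reg_l with (INR H); [trivial|].
  rewrite Cmod_esum_sqr.
  apply Rmult_le_compat_l with (r := INR M) in HT; [|trivial].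
  nra.
Qed.

(* Iterated van der Corput averages, each over the shifts 1 <= h < H
   but normalised by 1 / H. *)
Fixpoint vdc_avg (Y : R) (Hs : list nat) (s : nat -> R) (N : nat) : R :=
  match Hs with
  | nil => Cmod (esum s N) / Y
  | H :: Hs' =>
      rsum (fun j => vdc_avg Y Hs' (shift_diff (S j) s) (N - S j)) (H - 1) / INR H
  end.

(** Van der Corput's inequality acts on the innermost sum, hence the new shift bound at the end of
    the list. Cauchy-Schwarz carries the square through each outer average, using [H1 - 1 <= H1]. *)
Lemma vdc_avg_step (Y : R) (Hs : list nat) (H : nat) (s : nat -> R) (N : nat) :
  1 <= Y -> (forall H', In H' Hs -> (0 < H')%nat) ->
  (0 < H)%nat -> INR H <= Y -> INR N <= Y + 1 ->
  vdc_avg Y Hs s N ^ 2 <= 4 / INR H + 4 * vdc_avg Y (Hs ++ H :: nil) s N.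
Proof.
  intros HY. revert s N. induction Hs as [|H1 Hs IH]; intros s N HHs HH HHY HN.
  - simpl. assert (V := van_der_corput s N H HH).
    assert (Hpos : 0 < INR H) by now apply lt_0_INR.
    (* Bounding both N + H - 1 and N by 2 Y is what produces the two constants 4. *)
    assert (HM : INR (N + H - 1) <= 2 * Y).
    { rewrite minus_INR, plus_INR by lia. simpl. lra. }
    rewrite (rsum_ext _ (fun j => / Y * corr s N (S j)))
      by (intros; unfold corr, Rdiv; ring).
    rewrite rsum_scal.
    set (T := rsum (fun j => corr s N (S j)) (H - 1)) in *.
    assert (HT : 0 <= T) by (apply rsum_nonneg; intros; apply Cmod_ge_0).
    set (c := Cmod (esum s N)) in *.
    assert (B : INR H * c ^ 2 <= 2 * Y * (2 * Y + 2 * T)).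
    { eapply Rle_trans; [apply V|].
      apply Rmult_le_compat; [apply pos_INR| |trivial|lra].
      assert (0 <= INR N) by apply pos_INR. lra. }
    apply Rmult_le_reg_r with (INR H * Y ^ 2);
      [apply Rmult_lt_0_compat; [|apply pow_lt]; lra|].
    replace (c / Y * (c / Y * 1) * (INR H * Y ^ 2)) with (INR H * c ^ 2)
      by (field; lra).
    replace ((4 / INR H + 4 * (/ Y * T / INR H)) * (INR H * Y ^ 2)) with
      (2 * Y * (2 * Y + 2 * T)) by (field; lra).
    trivial.
  - simpl app. cbn [vdc_avg].
    assert (Hpos1 : 0 < INR H1) by (apply lt_0_INR, HHs; now left).
    assert (Hpos : 0 < INR H) by now apply lt_0_INR.
    set (u := fun j => vdc_avg Y Hs (shift_diff (S j) s) (N - S j)).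
    set (w := fun j => vdc_avg Y (Hs ++ H :: nil) (shift_diff (S j) s) (N - S j)).
    assert (Huw : rsum (fun j => u j ^ 2) (H1 - 1) <=
                  INR (H1 - 1) * (4 / INR H) + 4 * rsum w (H1 - 1)).
    { rewrite <- rsum_const, <- rsum_scal, <- rsum_plus.
      apply rsum_le; intros j Hj. apply IH; trivial.
      - intros; apply HHs; now right.
      - assert (INR (N - S j) <= INR N) by (apply le_INR; lia). lra. }
    assert (CS := rsum_cauchy_schwarz u (H1 - 1)).
    assert (Hle : INR (H1 - 1) <= INR H1) by (apply le_INR; lia).
    set (S2 := rsum (fun j => u j ^ 2) (H1 - 1)) in *.
    assert (HS2 : 0 <= S2) by (apply rsum_nonneg; intros; apply pow2_ge_0).
    assert (H4 : 0 < 4 / INR H) by (apply Rdiv_lt_0_compat; lra).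
    assert (E1 : rsum u (H1 - 1) ^ 2 <=
      INR H1 * (INR H1 * (4 / INR H) + 4 * rsum w (H1 - 1))).
    { eapply Rle_trans; [apply CS|].
      apply Rle_trans with (INR H1 * S2); [apply Rmult_le_compat_r; lra|].
      apply Rmult_le_compat_l; [lra|].
      eapply Rle_trans; [apply Huw|].
      apply Rplus_le_compat_r, Rmult_le_compat_r; lra. }
    apply Rmult_le_reg_r with (INR H1 ^ 2); [now apply pow_lt|].
    replace ((rsum u (H1 - 1) / INR H1) ^ 2 * INR H1 ^ 2)
      with (rsum u (H1 - 1) ^ 2) by (field; lra).
    eapply Rle_trans; [apply E1|]. apply Req_le. field. lra.
Qed.

(* The squaring of q makes the j-th condition 2 <= x_j * q ^ (2 ^ j); it gives
   1 / floor x_j <= q ^ (2 ^ j), as floor x >= x / 2. *)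
Fixpoint shifts_ok (Y q : R) (xs : list R) : Prop :=
  match xs with
  | nil => True
  | x :: xs' => (2 <= x * q ^ 2 /\ x <= Y) /\ shifts_ok Y (q ^ 2) xs'
  end.

Definition floor_nat (x : R) : nat := Z.to_nat (Int_part x).

Lemma floor_nat_spec (x : R) : 1 <= x ->
  (0 < floor_nat x)%nat /\ INR (floor_nat x) <= x < INR (floor_nat x) + 1.
Proof.
  intros Hx. destruct (base_Int_part x) as [H1 H2].
  assert (H0 : (0 < Int_part x)%Z) by (apply lt_IZR; lra).
  unfold floor_nat. rewrite INR_IZR_INZ, Z2Nat.id by lia. split; [lia|lra].
Qed.

Lemma cB_quadratic : cB ^ 2 = 4 + 4 * cB.
Proof. unfold cB. assert (H := pow2_sqrt 2 ltac:(lra)). nra. Qed.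

Lemma cB_bounds : 24 / 5 <= cB <= 5.
Proof.
  unfold cB. assert (H := pow2_sqrt 2 ltac:(lra)).
  assert (P := sqrt_pos 2). split; nra.
Qed.

(* B = 2 + 2 sqrt 2 is the fixed point of the descent: B^2 = 4 + 4 B. *)
Lemma vdc_avg_descent (Y : R) (s : nat -> R) (N : nat) (xs : list R) :
  1 <= Y -> INR N <= Y + 1 ->
  forall (Hs : list nat) (q : R),
  (forall H, In H Hs -> (0 < H)%nat) ->
  0 < q <= 1 -> shifts_ok Y q xs ->
  vdc_avg Y (Hs ++ map floor_nat xs) s N <= cB * q ^ (2 ^ length xs) ->
  vdc_avg Y Hs s N <= cB * q.
Proof.
  intros HY HN. induction xs as [|x xs IH]; intros Hs q HHs Hq Hok HW.
  - simpl in HW. rewrite app_nil_r, Rmult_1_r in HW. trivial.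
  - simpl in Hok. destruct Hok as [[Hx HxY] Hok].
    assert (Hq2 : 0 < q * q <= 1) by nra.
    assert (Hx1 : 2 <= x) by nra.
    destruct (floor_nat_spec x ltac:(lra)) as [F0 [F1 F2]].
    assert (Hpos : 0 < INR (floor_nat x)) by now apply lt_0_INR.
    assert (HHs' : forall H, In H (Hs ++ floor_nat x :: nil) -> (0 < H)%nat).
    { intros H Hin. apply in_app_or in Hin.
      destruct Hin as [Hin|[<-|[]]]; auto. }
    assert (IHq : vdc_avg Y (Hs ++ floor_nat x :: nil) s N <= cB * q ^ 2).
    { apply IH; trivial; [nra|].
      rewrite <- app_assoc, <- pow_mult. exact HW. }
    assert (St := vdc_avg_step Y Hs (floor_nat x) s N HY HHs F0 ltac:(lra) HN).
    assert (Hinv : 4 / INR (floor_nat x) <= 4 * q ^ 2).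
    { apply Rmult_le_reg_r with (INR (floor_nat x)); [trivial|].
      unfold Rdiv. rewrite Rmult_assoc, Rinv_l by lra.
      assert (1 <= INR (floor_nat x)) by (apply (le_INR 1); lia). nra. }
    assert (HB := cB_quadratic). assert (HB' := cB_bounds).
    apply Rsqr_incr_0_var; [|nra]. unfold Rsqr. nra.
Qed.

(** * Finite differences and the averaged bound *)

Fixpoint fdiff (k : nat) (s : nat -> R) : nat -> R :=
  match k with
  | O => s
  | S k' => fdiff k' (fun i => s (S i) - s i)
  end.

Lemma fdiff_ext (k : nat) (s t : nat -> R) :
  (forall i, s i = t i) -> forall n, fdiff k s n = fdiff k t n.
Proof.
  revert s t. induction k as [|k IH]; intros s t H n; simpl; [apply H|].
  apply IH; intros i. now rewrite !H.
Qed.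

Lemma fdiff_plus (k : nat) (s t : nat -> R) (n : nat) :
  fdiff k (fun i => s i + t i) n = fdiff k s n + fdiff k t n.
Proof.
  revert s t. induction k as [|k IH]; intros s t; simpl; [reflexivity|].
  rewrite <- IH. apply fdiff_ext; intros; ring.
Qed.

Lemma fdiff_zero (k n : nat) : fdiff k (fun _ => 0) n = 0.
Proof.
  induction k as [|k IH]; simpl; [reflexivity|].
  rewrite <- IH. apply fdiff_ext; intros; ring.
Qed.

Lemma fdiff_shift (k h : nat) (s : nat -> R) (n : nat) :
  fdiff k (fun i => s (i + h)%nat) n = fdiff k s (n + h).
Proof.
  revert s. induction k as [|k IH]; intros s; simpl; [reflexivity|].
  rewrite <- IH. reflexivity.
Qed.

(** A shift by [h] is a telescoping sum of [h] unit differences, and taking differences commutes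
    with sums and shifts. *)
Lemma fdiff_shift_diff (k h : nat) (s : nat -> R) (n : nat) :
  fdiff k (shift_diff h s) n = rsum (fun i => fdiff (S k) s (n + i)) h.
Proof.
  induction h as [|h IH].
  - simpl. rewrite <- (fdiff_zero k n). apply fdiff_ext; intros i.
    unfold shift_diff. rewrite Nat.add_0_r. ring.
  - cbn [rsum]. rewrite <- IH. cbn [fdiff].
    rewrite <- (fdiff_shift k h (fun i => s (S i) - s i)), <- fdiff_plus.
    apply fdiff_ext; intros i. unfold shift_diff.
    rewrite Nat.add_succ_r. ring.
Qed.

(** The effect of one van der Corput step: the order drops by one and both bounds are scaled by the
    shift, which keeps their ratio. *)
Lemma fdiff_shift_diff_bounds (k h N : nat) (s : nat -> R) (lam Lam : R) :
  (forall n, (n + S k < N)%nat -> lam <= fdiff (S k) s n <= Lam) ->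
  forall n, (n + k < N - h)%nat ->
    INR h * lam <= fdiff k (shift_diff h s) n <= INR h * Lam.
Proof.
  intros H n Hn. rewrite fdiff_shift_diff, <- !rsum_const.
  split; apply rsum_le; intros i Hi; apply H; lia.
Qed.

Lemma rsum_sqrt (H : nat) :
  rsum (fun j => sqrt (INR (S j))) (H - 1) <= 2 / 3 * (INR H * sqrt (INR H)).
Proof.
  induction H as [|H IH]; [simpl; lra|].
  destruct H as [|H]; [simpl; assert (P := sqrt_pos 1); lra|].
  replace (S (S H) - 1)%nat with (S (S H - 1)) by lia. cbn [rsum].
  replace (S (S H - 1)) with (S H) by lia.
  rewrite (S_INR (S H)). set (h := INR (S H)) in *.
  assert (Hh : 0 < h) by (apply lt_0_INR; lia).
  set (a := sqrt h) in *. set (b := sqrt (h + 1)).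
  assert (Ha : a ^ 2 = h) by (apply pow2_sqrt; lra).
  assert (Hb : b ^ 2 = h + 1) by (apply pow2_sqrt; lra).
  assert (Ha0 : 0 < a) by (apply sqrt_lt_R0; lra).
  assert (Hab : a < b) by (apply sqrt_lt_1; lra).
  eapply Rle_trans; [apply Rplus_le_compat_r, IH|].
  rewrite <- Hb, <- Ha.
  (* 2/3 a^3 + a <= 2/3 b^3, where a = a (b^2 - a^2). *)
  replace (2 / 3 * (a ^ 2 * a) + a) with
    (2 / 3 * (a ^ 2 * a) + a * (b ^ 2 - a ^ 2)) by (rewrite Hb, Ha; ring).
  assert (0 <= (b - a) ^ 2 * (2 * b + a)).
  { apply Rmult_le_pos; [apply pow2_ge_0|lra]. }
  nra.
Qed.

Lemma rsum_inv_sqrt (n : nat) :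
  rsum (fun j => / sqrt (INR (S j))) n <= 2 * sqrt (INR n).
Proof.
  induction n as [|n IH]; [simpl; rewrite sqrt_0; lra|].
  cbn [rsum]. rewrite S_INR. set (h := INR n) in *.
  assert (Hh : 0 <= h) by apply pos_INR.
  set (a := sqrt h) in *. set (b := sqrt (h + 1)).
  assert (Ha : a ^ 2 = h) by (apply pow2_sqrt; lra).
  assert (Hb : b ^ 2 = h + 1) by (apply pow2_sqrt; lra).
  assert (Ha0 : 0 <= a) by apply sqrt_pos.
  assert (Hb0 : 0 < b) by (apply sqrt_lt_R0; lra).
  (* As b^2 - a^2 = 1, this amounts to (b - a)^2 >= 0. *)
  assert (/ b <= 2 * (b - a)); [|lra].
  apply Rmult_le_reg_l with b; [trivial|]. rewrite Rinv_r by lra.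
  assert (0 <= (b - a) ^ 2) by apply pow2_ge_0. nra.
Qed.

Lemma avg_sqrt (x : R) : 1 <= x ->
  rsum (fun j => sqrt (INR (S j))) (floor_nat x - 1) / INR (floor_nat x)
    <= 2 / 3 * sqrt x.
Proof.
  intros Hx. destruct (floor_nat_spec x Hx) as [F0 [F1 F2]].
  assert (R := rsum_sqrt (floor_nat x)).
  assert (Hh : 0 < INR (floor_nat x)) by now apply lt_0_INR.
  set (h := INR (floor_nat x)) in *.
  apply Rle_trans with (2 / 3 * sqrt h).
  - apply Rmult_le_reg_r with h; [trivial|].
    unfold Rdiv. rewrite Rmult_assoc, Rinv_l by lra. lra.
  - apply Rmult_le_compat_l; [lra|]. apply sqrt_le_1; lra.
Qed.

Lemma avg_inv_sqrt (x : R) : 1 <= x ->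
  rsum (fun j => / sqrt (INR (S j))) (floor_nat x - 1) / INR (floor_nat x)
    <= 2 / sqrt x.
Proof.
  intros Hx. destruct (floor_nat_spec x Hx) as [F0 [F1 F2]].
  assert (R := rsum_inv_sqrt (floor_nat x - 1)).
  rewrite minus_INR in R by lia. change (INR 1) with 1 in R.
  assert (Hh : 1 <= INR (floor_nat x)) by (apply (le_INR 1); lia).
  set (h := INR (floor_nat x)) in *.
  (* (h - 1) x <= (h - 1) (h + 1) <= h^2 absorbs the rounding of x. *)
  assert (E : sqrt (h - 1) * sqrt x <= h).
  { rewrite <- sqrt_mult by lra. rewrite <- (sqrt_pow2 h) at 2 by lra.
    apply sqrt_le_1; nra. }
  assert (Hs : 0 < sqrt x) by (apply sqrt_lt_R0; lra).
  apply Rmult_le_reg_r with (h * sqrt x); [apply Rmult_lt_0_compat; lra|].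
  replace (2 / sqrt x * (h * sqrt x)) with (2 * h) by (field; lra).
  set (T := rsum _ _) in *.
  replace (T / h * (h * sqrt x)) with (T * sqrt x) by (field; lra).
  apply Rle_trans with (2 * sqrt (h - 1) * sqrt x); [|lra].
  apply Rmult_le_compat_r; lra.
Qed.

Definition rprod (xs : list R) : R := fold_right Rmult 1 xs.

Lemma rprod_pos (xs : list R) : (forall x, In x xs -> 1 <= x) -> 0 < rprod xs.
Proof.
  induction xs as [|x xs IH]; intros H; simpl; [lra|].
  apply Rmult_lt_0_compat.
  - specialize (H x (or_introl eq_refl)). lra.
  - apply IH; intros; apply H; now right.
Qed.

(** A shift h multiplies Lam / sqrt lam by sqrt h and 1 / sqrt lam by 1 / sqrt h. Averaging over h
    turns these into the factors 2/3 sqrt x and 2 / sqrt x, and the end of the list is the second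
    difference test. *)
Lemma vdc_avg_bound (Y : R) (xs : list R) :
  1 <= Y -> (forall x, In x xs -> 1 <= x) ->
  forall (s : nat -> R) (N : nat) (lam Lam : R),
  INR N <= Y + 1 -> 0 < lam <= Lam ->
  (forall n, (n + (length xs + 2) < N)%nat ->
     lam <= fdiff (length xs + 2) s n <= Lam) ->
  vdc_avg Y (map floor_nat xs) s N <=
    cA * Lam / sqrt lam * ((2 / 3) ^ length xs * sqrt (rprod xs)) +
    2 * cA / (Y * sqrt lam) * (2 ^ length xs / sqrt (rprod xs)).
Proof.
  intros HY. assert (HA := cA_pos).
  induction xs as [|x xs IH]; intros Hxs s N lam Lam HN Hl Hd.
  - simpl. rewrite sqrt_1.
    assert (T := second_difference_test s N Y lam Lam HY HN Hl).
    assert (Hs : 0 < sqrt lam) by (apply sqrt_lt_R0; lra).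
    apply Rmult_le_reg_r with Y; [lra|].
    unfold Rdiv at 1. rewrite Rmult_assoc, Rinv_l by lra.
    rewrite Rmult_1_r.
    eapply Rle_trans; [apply T|].
    + intros i Hi. apply (Hd i). simpl. lia.
    + apply Req_le. field. lra.
  - specialize (IH ltac:(intros; apply Hxs; now right)).
    assert (Hx : 1 <= x) by (apply Hxs; now left).
    assert (HP : 0 < rprod xs) by (apply rprod_pos; intros; apply Hxs; now right).
    cbn [map vdc_avg length rprod fold_right].
    fold (rprod xs). rewrite sqrt_mult by lra.
    set (k := length xs) in *. set (h := floor_nat x).
    assert (Hh : 0 < INR h) by (apply lt_0_INR, floor_nat_spec; lra).
    assert (Hsl : 0 < sqrt lam) by (apply sqrt_lt_R0; lra).
    assert (Hsx : 0 < sqrt x) by (apply sqrt_lt_R0; lra).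
    assert (HsP : 0 < sqrt (rprod xs)) by now apply sqrt_lt_R0.
    assert (S1 := avg_sqrt x Hx). assert (S2 := avg_inv_sqrt x Hx).
    fold h in S1, S2.
    set (c1 := cA * Lam / sqrt lam * ((2 / 3) ^ k * sqrt (rprod xs))).
    set (c2 := 2 * cA / (Y * sqrt lam) * (2 ^ k / sqrt (rprod xs))).
    assert (Hp1 : 0 < (2 / 3) ^ k) by (apply pow_lt; lra).
    assert (Hp2 : 0 < 2 ^ k) by (apply pow_lt; lra).
    assert (Hc1 : 0 <= c1).
    { unfold c1. apply Rlt_le, Rmult_lt_0_compat; [|now apply Rmult_lt_0_compat].
      apply Rdiv_lt_0_compat; [apply Rmult_lt_0_compat|]; lra. }
    assert (Hc2 : 0 <= c2).
    { unfold c2. apply Rlt_le, Rmult_lt_0_compat; [|now apply Rdiv_lt_0_compat].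
      apply Rdiv_lt_0_compat; apply Rmult_lt_0_compat; lra. }
    apply Rle_trans with
      ((c1 * rsum (fun j => sqrt (INR (S j))) (h - 1) +
        c2 * rsum (fun j => / sqrt (INR (S j))) (h - 1)) / INR h).
    { unfold Rdiv. apply Rmult_le_compat_r; [now apply Rlt_le, Rinv_0_lt_compat|].
      rewrite <- !rsum_scal, <- rsum_plus. apply rsum_le; intros j Hj.
      set (g := INR (S j)). assert (Hg : 0 < g) by (apply lt_0_INR; lia).
      assert (Hsg : 0 < sqrt g) by now apply sqrt_lt_R0.
      assert (Hg2 : sqrt g ^ 2 = g) by (apply pow2_sqrt; lra).
      eapply Rle_trans.
      { apply (IH (shift_diff (S j) s) (N - S j)%nat (g * lam) (g * Lam)).
        - assert (INR (N - S j) <= INR N) by (apply le_INR; lia). lra.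
        - split; [|apply Rmult_le_compat_l]; nra.
        - apply fdiff_shift_diff_bounds. intros n Hn. apply (Hd n).
          simpl length. fold k. lia. }
      apply Req_le. rewrite sqrt_mult by lra. unfold c1, c2.
      rewrite <- Hg2 at 1. field. repeat split; lra. }
    replace ((c1 * rsum (fun j => sqrt (INR (S j))) (h - 1) +
        c2 * rsum (fun j => / sqrt (INR (S j))) (h - 1)) / INR h) with
      (c1 * (rsum (fun j => sqrt (INR (S j))) (h - 1) / INR h) +
       c2 * (rsum (fun j => / sqrt (INR (S j))) (h - 1) / INR h)) by (field; lra).
    eapply Rle_trans.
    { apply Rplus_le_compat; apply Rmult_le_compat_l; [trivial|apply S1|trivial|apply S2]. }
    apply Req_le. unfold c1, c2. simpl pow. field. repeat split; lra.
Qed.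

(** * Choice of the shifts *)

Lemma pow_le_self (z : R) (m : nat) : 0 <= z <= 1 -> (m <> 0)%nat -> z ^ m <= z.
Proof.
  intros Hz Hm. destruct m as [|m]; [lia|]. simpl.
  assert (H := pow_incr z 1 m ltac:(lra)). rewrite pow1 in H. nra.
Qed.

(** The least admissible shifts are 2 / q^(2^j) for j = 1, ..., k, with product 2^k / q^(2^(k+1) -
    2). The last of them is the largest and is at most [Y], so this product is at most [Y ^ k]. *)
Lemma shifts_product_bound (k : nat) : forall q Y : R,
  0 < q <= 1 -> 2 <= Y * q ^ (2 ^ k) ->
  2 ^ k * q ^ 2 <= Y ^ k * q ^ (2 ^ S k).
Proof.
  induction k as [|k IH]; intros q Y Hq HY; [simpl; lra|].
  assert (Hq2 : 0 < q ^ 2 <= 1) by nra.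
  assert (E : forall n, (q ^ 2) ^ (2 ^ n) = q ^ (2 ^ S n)).
  { intros n. rewrite <- pow_mult. f_equal. }
  assert (HY0 : 0 < Y).
  { apply Rmult_lt_reg_r with (q ^ (2 ^ S k)); [apply pow_lt|]; lra. }
  rewrite <- E in HY |- *.
  specialize (IH (q ^ 2) Y Hq2 HY).
  assert (H1 : (q ^ 2) ^ (2 ^ k) <= q ^ 2)
    by (apply pow_le_self; [lra|now apply Nat.pow_nonzero]).
  assert (H2 : 2 <= Y * q ^ 2) by nra.
  assert (P2 : 0 < 2 ^ k) by (apply pow_lt; lra).
  change (2 ^ S k) with (2 * 2 ^ k). change (Y ^ S k) with (Y * Y ^ k).
  apply Rle_trans with (Y * (2 ^ k * (q ^ 2) ^ 2)); [|rewrite Rmult_assoc; apply Rmult_le_compat_l; lra].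
  assert (0 <= 2 ^ k * q ^ 2) by nra.
  replace (Y * (2 ^ k * (q ^ 2) ^ 2)) with ((Y * q ^ 2) * (2 ^ k * q ^ 2)) by ring.
  replace (2 * 2 ^ k * q ^ 2) with (2 * (2 ^ k * q ^ 2)) by ring.
  now apply Rmult_le_compat_r.
Qed.

(** Raising the shifts from their least values to [Y], the last ones first, makes the product sweep
    the whole range from the least product to [Y ^ k]. *)
Lemma shifts_with_product (Y : R) (k : nat) : forall q P : R,
  0 < q <= 1 -> 2 <= Y * q ^ (2 ^ k) ->
  2 ^ k * q ^ 2 <= P * q ^ (2 ^ S k) -> P <= Y ^ k ->
  exists xs, length xs = k /\ shifts_ok Y q xs /\ rprod xs = P.
Proof.
  induction k as [|k IH]; intros q P Hq HY HP1 HP2.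
  - exists nil. simpl in *. repeat split; trivial.
    apply Rle_antisym; [apply Rmult_le_reg_r with (q * q); nra|lra].
  - assert (Hq2 : 0 < q ^ 2 <= 1) by nra.
    assert (E : forall n, (q ^ 2) ^ (2 ^ n) = q ^ (2 ^ S n)).
    { intros n. rewrite <- pow_mult. f_equal. }
    assert (HY0 : 0 < Y).
    { apply Rmult_lt_reg_r with (q ^ (2 ^ S k)); [apply pow_lt|]; lra. }
    rewrite <- E in HY, HP1.
    assert (HYk : 0 < Y ^ k) by now apply pow_lt.
    change (Y ^ S k) with (Y * Y ^ k) in HP2.
    change (2 ^ S k) with (2 * 2 ^ k) in HP1.
    assert (HB := shifts_product_bound k (q ^ 2) Y Hq2 HY).
    (* Either the first shift stays admissible when the others multiply to [Y ^ k], or it takes its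
       least value 2 / q^2 and the others supply the rest of [P]. *)
    destruct (Rle_lt_dec (2 / q ^ 2) (P / Y ^ k)) as [Hc|Hc].
    + destruct (IH (q ^ 2) (Y ^ k) Hq2 HY HB (Rle_refl _)) as [xs [L [O Pr]]].
      exists (P / Y ^ k :: xs). simpl rprod. fold (rprod xs).
      simpl length. rewrite L, Pr.
      repeat split; trivial; try (field; lra).
      * apply Rmult_le_compat_r with (r := q ^ 2) in Hc; [|lra].
        unfold Rdiv in Hc at 1. rewrite Rmult_assoc, Rinv_l in Hc by lra. lra.
      * apply Rmult_le_reg_r with (Y ^ k); [trivial|].
        unfold Rdiv. rewrite Rmult_assoc, Rinv_l by lra. lra.
    + destruct (IH (q ^ 2) (P * q ^ 2 / 2) Hq2 HY) as [xs [L [O Pr]]].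
      * set (z := (q ^ 2) ^ (2 ^ S k)) in *. nra.
      * apply Rmult_lt_compat_r with (r := q ^ 2 * Y ^ k) in Hc; [|nra].
        replace (P / Y ^ k * (q ^ 2 * Y ^ k)) with (P * q ^ 2) in Hc by (field; lra).
        replace (2 / q ^ 2 * (q ^ 2 * Y ^ k)) with (2 * Y ^ k) in Hc by (field; lra).
        lra.
      * exists (2 / q ^ 2 :: xs). simpl rprod. fold (rprod xs).
        simpl length. rewrite L, Pr.
        repeat split; trivial; try (field; lra).
        -- apply Req_le. field. lra.
        -- assert (H1 : (q ^ 2) ^ (2 ^ k) <= q ^ 2)
             by (apply pow_le_self; [lra|now apply Nat.pow_nonzero]).
           apply Rmult_le_reg_r with (q ^ 2); [lra|].
           unfold Rdiv. rewrite Rmult_assoc, Rinv_l by lra. nra.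
Qed.

(** * From derivatives to differences *)

Lemma clamp_id (a b t : R) : a <= t <= b -> Rmax a (Rmin b t) = t.
Proof. intros H. rewrite Rmin_right, Rmax_right; lra. Qed.

Lemma mvt_within (I : R -> Prop) (g g' : R -> R) (a b lam Lam : R) :
  (forall x y z, I x -> I z -> x <= y <= z -> I y) ->
  (forall x, I x -> has_deriv_within I g g' x) ->
  (forall x, I x -> lam <= g' x <= Lam) ->
  I a -> I b -> a < b ->
  lam * (b - a) <= g b - g a <= Lam * (b - a).
Proof.
  intros HI Hd Hb Ia Ib Hab.
  assert (HIab : forall x, a <= x <= b -> I x) by (intros; now apply (HI a x b)).
  (* g may be one-sided at b, so the mean value theorem is applied to its
     extension by constants outside [a, b]. *)
  set (cl := fun t => Rmax a (Rmin b t)).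
  assert (Hcl : forall t, a <= cl t <= b).
  { intros t. unfold cl. split; [apply Rmax_l|].
    apply Rmax_lub; [lra|apply Rmin_l]. }
  (* With this, one-sided estimates of [g] at an endpoint become two-sided ones for [g (cl t)]. *)
  assert (Hlip : forall t x, a <= x <= b -> Rabs (cl t - x) <= Rabs (t - x)).
  { intros t x Hx. unfold cl, Rmax, Rmin.
    repeat destruct Rle_dec; unfold Rabs; repeat destruct Rcase_abs; lra. }
  destruct (MVT_gen (fun t => g (cl t)) a b g') as [c [Hc E]].
  - intros x Hx. rewrite Rmin_left, Rmax_right in Hx by lra.
    apply is_derive_Reals. intros eps Heps.
    destruct (Hd x (HIab x ltac:(lra)) (eps / 2) ltac:(lra)) as [del [Hdel HD]].
    assert (Hm : 0 < Rmin del (Rmin (x - a) (b - x)))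
      by (repeat apply Rmin_glb_lt; lra).
    exists (mkposreal _ Hm). simpl. intros h Hh0 Hh.
    assert (Hh1 := Rlt_le_trans _ _ _ Hh (Rmin_l _ _)).
    assert (Hh2 := Rlt_le_trans _ _ _ Hh (Rmin_r _ _)).
    assert (Hh3 := Rlt_le_trans _ _ _ Hh2 (Rmin_l _ _)).
    assert (Hh4 := Rlt_le_trans _ _ _ Hh2 (Rmin_r _ _)).
    apply Rabs_def2 in Hh3. apply Rabs_def2 in Hh4.
    unfold cl. rewrite !clamp_id by lra.
    specialize (HD (x + h) (HIab (x + h) ltac:(lra))).
    replace (x + h - x) with h in HD by ring.
    specialize (HD Hh1).
    assert (Hp : 0 < Rabs h) by now apply Rabs_pos_lt.
    replace ((g (x + h) - g x) / h - g' x) with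
      ((g (x + h) - g x - g' x * h) / h) by (field; trivial).
    unfold Rdiv. rewrite Rabs_mult, Rabs_inv.
    apply Rmult_lt_reg_r with (Rabs h); [trivial|].
    rewrite Rmult_assoc, Rinv_l by lra. nra.
  - intros x Hx. rewrite Rmin_left, Rmax_right in Hx by lra.
    intros eps Heps.
    destruct (Hd x (HIab x Hx) 1 Rlt_0_1) as [del [Hdel HD]].
    set (K := 1 + Rabs (g' x)).
    assert (HK : 0 < K) by (unfold K; assert (H := Rabs_pos (g' x)); lra).
    exists (Rmin del (eps / K)).
    split; [apply Rmin_glb_lt; [trivial|now apply Rdiv_lt_0_compat]|].
    intros y [_ Hy]. simpl in Hy |- *. unfold Rdist in *.
    replace (cl x) with x by (unfold cl; now rewrite clamp_id).
    assert (Hy1 := Rlt_le_trans _ _ _ Hy (Rmin_l _ _)).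
    assert (Hy2 := Rlt_le_trans _ _ _ Hy (Rmin_r _ _)).
    assert (L := Hlip y x Hx).
    specialize (HD (cl y) (HIab _ (Hcl y)) ltac:(lra)).
    replace (g (cl y) - g x) with
      ((g (cl y) - g x - g' x * (cl y - x)) + g' x * (cl y - x)) by ring.
    eapply Rle_lt_trans; [apply Rabs_triang|].
    rewrite Rabs_mult.
    apply Rle_lt_trans with (K * Rabs (cl y - x)); [unfold K; lra|].
    apply Rle_lt_trans with (K * Rabs (y - x)); [apply Rmult_le_compat_l; lra|].
    apply Rmult_lt_reg_l with (/ K); [now apply Rinv_0_lt_compat|].
    rewrite <- Rmult_assoc, Rinv_l by lra. unfold Rdiv in Hy2. lra.
  - rewrite Rmin_left, Rmax_right in Hc by lra.
    unfold cl in E. rewrite !clamp_id in E by lra.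
    specialize (Hb c (HIab c Hc)). rewrite E. nra.
Qed.

(** The induction passes to the functions F k (x + 1) - F k x on the set where x and x + 1 both lie
    in [I], so [I] and [F] must vary. The mean value theorem on [x, x + 1] turns the bounds on
    [F (S d)] into bounds on the increments of [F d]. *)
Lemma fdiff_mvt (d : nat) : forall (I : R -> Prop) (F : nat -> R -> R) (a lam Lam : R),
  (forall x y z, I x -> I z -> x <= y <= z -> I y) ->
  (forall k x, (k < d)%nat -> I x -> has_deriv_within I (F k) (F (S k)) x) ->
  (forall x, I x -> lam <= F d x <= Lam) ->
  I a -> I (a + INR d) ->
  lam <= fdiff d (fun i => F 0%nat (a + INR i)) 0 <= Lam.
Proof.
  induction d as [|d IH]; intros I F a lam Lam HI Hd Hb Ia Iad.
  - simpl. rewrite Rplus_0_r. now apply Hb.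
  - rewrite S_INR in Iad. assert (Hp := pos_INR d).
    cbn [fdiff].
    rewrite (fdiff_ext d _ (fun i => F 0%nat (a + INR i + 1) - F 0%nat (a + INR i)))
      by (intros; rewrite S_INR; do 2 f_equal; ring).
    apply (IH (fun x => I x /\ I (x + 1)) (fun k x => F k (x + 1) - F k x)).
    + intros x y z [X1 X2] [Z1 Z2] H.
      split; [now apply (HI x y z)|apply (HI (x + 1) (y + 1) (z + 1)); trivial; lra].
    + intros k x Hk [Ix Ix1] eps Heps.
      destruct (Hd k x ltac:(lia) Ix (eps / 2) ltac:(lra)) as [d1 [P1 D1]].
      destruct (Hd k (x + 1) ltac:(lia) Ix1 (eps / 2) ltac:(lra)) as [d2 [P2 D2]].
      exists (Rmin d1 d2). split; [now apply Rmin_glb_lt|].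
      intros y [Iy Iy1] Hy.
      specialize (D1 y Iy (Rlt_le_trans _ _ _ Hy (Rmin_l _ _))).
      specialize (D2 (y + 1) Iy1).
      replace (y + 1 - (x + 1)) with (y - x) in D2 by ring.
      specialize (D2 (Rlt_le_trans _ _ _ Hy (Rmin_r _ _))).
      replace (F k (y + 1) - F k y - (F k (x + 1) - F k x)
               - (F (S k) (x + 1) - F (S k) x) * (y - x)) with
        ((F k (y + 1) - F k (x + 1) - F (S k) (x + 1) * (y - x))
         - (F k y - F k x - F (S k) x * (y - x))) by ring.
      unfold Rminus at 1. eapply Rle_trans; [apply Rabs_triang|].
      rewrite Rabs_Ropp. lra.
    + intros x [Ix Ix1].
      assert (M := mvt_within I (F d) (F (S d)) x (x + 1) lam Lam HI
        ltac:(intros; apply Hd; [lia|trivial]) Hb Ix Ix1 ltac:(lra)).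
      lra.
    + split; [trivial|]. apply (HI a (a + 1) (a + (INR d + 1))); trivial; lra.
    + split.
      * apply (HI a (a + INR d) (a + (INR d + 1))); trivial; lra.
      * now replace (a + INR d + 1) with (a + (INR d + 1)) by ring.
Qed.

(** * The derivative test *)

Lemma cA_upper : cA <= 57 / 20.
Proof.
  assert (HA := cA_pos). assert (HQ := cA_quadratic).
  assert (P3 := PI2_3_2).
  assert (P := PI_RGT_0).
  assert (Hp : 0 < sqrt PI) by now apply sqrt_lt_R0.
  assert (Hp2 : sqrt PI ^ 2 = PI) by (apply pow2_sqrt; lra).
  assert (4 / sqrt PI <= 231 / 100).
  { apply Rmult_le_reg_r with (sqrt PI); [trivial|].
    unfold Rdiv at 1. rewrite Rmult_assoc, Rinv_l by lra. nra. }
  nra.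
Qed.

(** Equality holds at k = 1; from then on the left side grows by 4/3 and the right side at least
    fourfold. *)
Lemma four_thirds_pow (k : nat) : (1 <= k)%nat ->
  (4 / 3) ^ k <= / 3 * 2 ^ (2 ^ k).
Proof.
  induction k as [|k IH]; [lia|]. intros _.
  destruct k as [|k]; [simpl; lra|].
  specialize (IH ltac:(lia)).
  replace (2 ^ 2 ^ S (S k)) with ((2 ^ 2 ^ S k) ^ 2)
    by (rewrite <- pow_mult; f_equal; simpl; lia).
  assert (4 <= 2 ^ 2 ^ S k).
  { replace 4 with (2 ^ 2) by ring. apply Rle_pow; [lra|].
    change 2%nat with (2 ^ 1)%nat at 1. apply Nat.pow_le_mono_r; lia. }
  change ((4 / 3) ^ S (S k)) with (4 / 3 * (4 / 3) ^ S k). nra.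
Qed.

(** The numerical sizes of A and B enter here: 8 A^2 <= 65 and 65 / 3 <= 23 <= B^2. *)
Lemma constants_bound (k : nat) : (1 <= k)%nat ->
  8 * cA ^ 2 * (2 / 3) ^ k * 2 ^ k <= cB ^ 2 * 2 ^ (2 ^ k).
Proof.
  intros Hk. assert (H := four_thirds_pow k Hk).
  assert (HA := cA_pos). assert (HA' := cA_upper). assert (HB := cB_bounds).
  rewrite Rmult_assoc, <- Rpow_mult_distr.
  replace (2 / 3 * 2) with (4 / 3) by field.
  set (z := 2 ^ 2 ^ k) in *.
  assert (Hz : 0 < z) by (apply pow_lt; lra).
  assert (cA ^ 2 <= 65 / 8) by nra.
  assert (23 <= cB ^ 2) by nra.
  apply Rle_trans with (65 * (/ 3 * z)); [|nra].
  assert (0 < (4 / 3) ^ k) by (apply pow_lt; lra).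
  apply Rmult_le_compat; nra.
Qed.

Lemma le_half_of_sqr (a b : R) : 0 <= b -> 4 * a ^ 2 <= b ^ 2 -> a <= b / 2.
Proof. intros Hb H. nra. Qed.

(** The last three hypotheses encode, in order, that [G] dominates the three terms of the maximum
    divided by B, with roots cleared by powers and the powers of d - 2 replaced by 1. *)
Lemma discrete_derivative_test
  (s : nat -> R) (N k : nat) (Y lam Lam G : R) :
  (1 <= k)%nat -> 4 <= Y -> INR N <= Y + 1 -> 0 < lam <= Lam -> 0 < G ->
  (forall n, (n + (k + 2) < N)%nat -> lam <= fdiff (k + 2) s n <= Lam) ->
  2 ^ (2 ^ k) * Lam <= lam * Y * (G ^ (2 ^ k)) ^ 2 ->
  2 ^ S (2 ^ k) * ((2 / 3) ^ k) ^ 2 * cA ^ 2 * Lam ^ 2 * G ^ 2 <=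
    cB ^ 2 * lam * (G ^ (2 ^ k)) ^ 4 ->
  (4 * 2 ^ k * cA) ^ 2 <= cB ^ 2 * (lam * Y ^ (k + 2)) * (G ^ (2 ^ k)) ^ 2 ->
  Cmod (esum s N) / Y <= cB * G.
Proof.
  intros Hk HY HN Hl HG Hd HhA HhB HhC.
  assert (HB := cB_bounds). assert (HA := cA_pos).
  destruct (Rle_lt_dec G 1) as [HG1|HG1].
  (* For G > 1 the trivial bound (Y + 1) / Y <= 2 <= B suffices. *)
  2: { apply Rmult_le_reg_r with Y; [lra|].
       unfold Rdiv. rewrite Rmult_assoc, Rinv_l by lra.
       assert (T := esum_trivial s N). assert (Y + 1 <= 2 * Y) by lra.
       assert (2 <= cB * G) by nra. nra. }
  set (z := G ^ 2 ^ k) in *. set (r := (2 / 3) ^ k) in *.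
  set (K := 2 ^ k) in *.
  assert (Hz : 0 < z) by now apply pow_lt.
  assert (Hr : 0 < r) by (apply pow_lt; lra).
  assert (HK : 0 < K) by (apply pow_lt; lra).
  assert (Hz2 : G ^ 2 ^ S k = z ^ 2).
  { unfold z. rewrite <- pow_mult. f_equal. simpl. lia. }
  assert (HkK : (S k <= 2 ^ k)%nat).
  { apply Nat.pow_gt_lin_r. lia. }
  assert (H4 : 4 <= 2 ^ 2 ^ k).
  { replace 4 with (2 ^ 2) by ring. apply Rle_pow; [lra|]. lia. }
  (* The least value 2 / G^(2^k) of the last shift must not exceed [Y]. *)
  assert (HYz : 2 <= Y * z).
  { assert (4 * lam <= lam * Y * z ^ 2).
    { eapply Rle_trans; [|apply HhA]. apply Rmult_le_compat; lra. }
    assert (4 <= Y * z ^ 2) by (apply Rmult_le_reg_l with lam; lra).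
    assert (4 * Y <= (Y * z) ^ 2) by nra.
    assert (0 < Y * z) by nra. nra. }
  (* [Pmin] is the product of the least admissible shifts; [P3] is the product at which the term
     decreasing in P equals B z / 2. *)
  pose (Pmin := K * G ^ 2 / z ^ 2).
  pose (P3 := (4 * K * cA) ^ 2 / (Y ^ 2 * lam * cB ^ 2 * z ^ 2)).
  assert (HY2 : 0 < Y ^ 2) by (apply pow_lt; lra).
  assert (Hzz : 0 < z ^ 2) by now apply pow_lt.
  assert (HBB : 0 < cB ^ 2) by (apply pow_lt; lra).
  assert (Hden : 0 < Y ^ 2 * lam * cB ^ 2 * z ^ 2)
    by (repeat apply Rmult_lt_0_compat; lra).
  assert (HPmin : 0 < Pmin).
  { apply Rdiv_lt_0_compat; [apply Rmult_lt_0_compat; [|apply pow_lt]|]; lra. }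
  (* The least product meeting both lower bounds, which is best for the term increasing in P. *)
  pose (P := Rmax Pmin P3).
  assert (HP1 : Pmin <= P) by apply Rmax_l.
  assert (HP3 : P3 <= P) by apply Rmax_r.
  assert (HPpos : 0 < P) by lra.
  assert (EPmin : Pmin * z ^ 2 = K * G ^ 2) by (unfold Pmin; field; lra).
  assert (EP3 : P3 * (Y ^ 2 * lam * cB ^ 2 * z ^ 2) = (4 * K * cA) ^ 2)
    by (unfold P3; field; repeat split; lra).
  destruct (shifts_with_product Y k G P ltac:(lra) HYz) as [xs [Lx [Ox Px]]].
  { rewrite Hz2. fold K. rewrite <- EPmin. apply Rmult_le_compat_r; lra. }
  { apply Rmax_lub.
    - apply Rmult_le_reg_r with (z ^ 2); [trivial|]. rewrite EPmin, <- Hz2.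
      now apply shifts_product_bound.
    - apply Rmult_le_reg_r with (Y ^ 2 * lam * cB ^ 2 * z ^ 2); [trivial|].
      rewrite EP3. eapply Rle_trans; [apply HhC|].
      apply Req_le. rewrite pow_add. ring. }
  assert (Hx1 : forall x, In x xs -> 1 <= x).
  { clear - Ox HG HG1. assert (HG' : 0 < G <= 1) by lra. clear HG HG1.
    revert G HG' Ox. induction xs as [|x xs IH]; intros G HG Ox y [].
    - subst y. destruct Ox as [[H _] _].
      assert (0 < G ^ 2 <= 1) by nra. nra.
    - destruct Ox as [_ O]. apply (IH (G ^ 2)); trivial. nra. }
  apply (vdc_avg_descent Y s N xs ltac:(lra) HN nil G); trivial.
  { intros H []. }
  { lra. }
  rewrite Lx. fold z.
  eapply Rle_trans.
  { apply (vdc_avg_bound Y xs ltac:(lra) Hx1 s N lam Lam HN Hl).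
    rewrite Lx. exact Hd. }
  rewrite Lx, Px. fold r K.
  assert (HsP : sqrt P ^ 2 = P) by (apply pow2_sqrt; lra).
  assert (Hsl : sqrt lam ^ 2 = lam) by (apply pow2_sqrt; lra).
  assert (HsP0 : 0 < sqrt P) by now apply sqrt_lt_R0.
  assert (Hsl0 : 0 < sqrt lam) by (apply sqrt_lt_R0; lra).
  assert (HBz : 0 < cB * z) by (apply Rmult_lt_0_compat; lra).
  assert (Second : cA * Lam / sqrt lam * (r * sqrt P) <= cB * z / 2).
  { apply le_half_of_sqr; [lra|].
    replace (4 * (cA * Lam / sqrt lam * (r * sqrt P)) ^ 2) with
      (4 * cA ^ 2 * Lam ^ 2 * r ^ 2 * P / lam)
      by (rewrite <- HsP, <- Hsl at 1; field; lra).
    apply Rmult_le_reg_r with lam; [lra|].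
    unfold Rdiv. rewrite Rmult_assoc, Rinv_l, Rmult_1_r by lra.
    (* For P = [P3], the first hypothesis is combined with [constants_bound] and squared; for P =
       [Pmin], the second one applies because k + 1 <= 2^k. *)
    unfold P, Rmax. destruct Rle_dec as [_|_].
    - apply Rmult_le_reg_r with (Y ^ 2 * lam * cB ^ 2 * z ^ 2); [trivial|].
      rewrite Rmult_assoc, EP3.
      assert (C := constants_bound k Hk). fold r K in C.
      assert (E : 8 * cA ^ 2 * r * K * Lam <= cB ^ 2 * (lam * Y * z ^ 2)).
      { apply Rle_trans with (cB ^ 2 * (2 ^ 2 ^ k * Lam)).
        - rewrite <- Rmult_assoc. apply Rmult_le_compat_r; lra.
        - apply Rmult_le_compat_l; lra. }
      assert (E0 : 0 <= 8 * cA ^ 2 * r * K * Lam).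
      { replace (8 * cA ^ 2 * r * K * Lam) with (8 * cA ^ 2 * (r * K * Lam)) by ring.
        apply Rmult_le_pos; [generalize (pow2_ge_0 cA); lra|].
        apply Rlt_le, Rmult_lt_0_compat; [now apply Rmult_lt_0_compat|lra]. }
      assert (E2 := pow_incr _ _ 2 (conj E0 E)).
      eapply Rle_trans; [|eapply Rle_trans; [apply E2|]]; apply Req_le; ring.
    - apply Rmult_le_reg_r with (z ^ 2); [trivial|].
      rewrite Rmult_assoc, EPmin.
      eapply Rle_trans; [|eapply Rle_trans; [apply HhB|apply Req_le; ring]].
      assert (H2 : 4 * K <= 2 ^ S (2 ^ k)).
      { replace (4 * K) with (2 ^ S (S k)) by (unfold K; simpl; ring).
        apply Rle_pow; [lra|lia]. }
      replace (4 * cA ^ 2 * Lam ^ 2 * r ^ 2 * (K * G ^ 2)) with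
        ((4 * K) * (r ^ 2 * cA ^ 2 * Lam ^ 2 * G ^ 2)) by ring.
      replace (2 ^ S (2 ^ k) * r ^ 2 * cA ^ 2 * Lam ^ 2 * G ^ 2) with
        (2 ^ S (2 ^ k) * (r ^ 2 * cA ^ 2 * Lam ^ 2 * G ^ 2)) by ring.
      apply Rmult_le_compat_r; [|trivial].
      generalize (pow2_ge_0 (r * cA * Lam * G)). lra. }
  assert (Third : 2 * cA / (Y * sqrt lam) * (K / sqrt P) <= cB * z / 2).
  { apply le_half_of_sqr; [lra|].
    replace (4 * (2 * cA / (Y * sqrt lam) * (K / sqrt P)) ^ 2) with
      ((4 * K * cA) ^ 2 / (Y ^ 2 * lam * P))
      by (rewrite <- HsP, <- Hsl at 1; field; repeat split; lra).
    assert (HYlP : 0 < Y ^ 2 * lam * P) by (repeat apply Rmult_lt_0_compat; lra).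
    apply Rmult_le_reg_r with (Y ^ 2 * lam * P); [trivial|].
    unfold Rdiv. rewrite Rmult_assoc, Rinv_l, Rmult_1_r, <- EP3 by lra.
    replace ((cB * z) ^ 2 * (Y ^ 2 * lam * P)) with
      (P * (Y ^ 2 * lam * cB ^ 2 * z ^ 2)) by ring.
    apply Rmult_le_compat_r; lra. }
  lra.
Qed.

Lemma exp_sum_esum (f : R -> R) (s : nat -> R) (X Y : R) (N : nat) :
  N = Z.to_nat (Int_part (X + Y) - up X + 1) ->
  (forall i, (i < N)%nat -> f (IZR (up X) + INR i) = s i) ->
  exp_sum f X Y = esum s N.
Proof.
  intros HN Hs. unfold exp_sum, int_range. rewrite <- HN.
  unfold esum. rewrite (csum_ext _ (fun i => e (f (IZR (up X + Z.of_nat (0 + i))))))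
    by (intros; rewrite <- Hs, plus_IZR, <- INR_IZR_INZ by trivial; reflexivity).
  clear HN Hs. generalize 0%nat.
  induction N as [|N IH]; intros a; [reflexivity|].
  cbn [seq map fold_right]. rewrite IH.
  change (S N) with (1 + N)%nat. rewrite csum_cat. cbn [csum].
  rewrite Cplus_0_l, Nat.add_0_r. f_equal. apply csum_ext; intros.
  now rewrite Nat.add_succ_comm.
Qed.

Lemma Rpower_pow_mul (x c t : R) (n : nat) :
  0 < x -> c * INR n = t -> Rpower x c ^ n = Rpower x t.
Proof.
  intros Hx <-. rewrite <- Rpower_pow by apply exp_pos. apply Rpower_mult.
Qed.

Lemma Rpower_ge_1 (x c : R) : 1 <= x -> 0 <= c -> 1 <= Rpower x c.
Proof.
  intros Hx Hc. rewrite <- (Rpower_O x) by lra. destruct Hx as [Hx|<-].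
  - now apply Rle_Rpower; [left|].
  - unfold Rpower. rewrite ln_1, !Rmult_0_r. lra.
Qed.

Theorem theorem11 (d : nat) (X Y lam Lam : R) (f : R -> R) (F : nat -> R -> R) :
  (3 <= d)%nat ->
  (Int_part Y > Z.of_nat d)%Z ->
  (forall x, X < x <= X + Y -> F 0%nat x = f x) ->
  Cd_on d (fun x => X < x <= X + Y) F ->
  0 < lam ->
  (forall x, X < x <= X + Y -> lam <= F d x <= Lam) ->
  Cmod (exp_sum f X Y) / Y <=
    Rmax (A_d d * Rpower (Lam / (lam * Y)) (2 / Dd d))
      (Rmax (B_d d * Rpower (Lam ^ 2 / lam) (1 / (Dd d - 2)))
            (C_d d * Rpower (lam * Y ^ d) (- (2 / Dd d)))).
Proof.
  intros Hd HYd Hf [HF _] Hlam Hbnd.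
  assert (HY : 4 <= Y).
  { destruct (base_Int_part Y) as [H _].
    apply Rle_trans with (IZR (Int_part Y)); [apply IZR_le; lia|lra]. }
  assert (HL : lam <= Lam) by (specialize (Hbnd (X + Y) ltac:(lra)); lra).
  set (N := Z.to_nat (Int_part (X + Y) - up X + 1)).
  pose (s := fun i : nat => F 0%nat (IZR (up X) + INR i)).
  destruct (archimed X) as [U1 U2].
  destruct (base_Int_part (X + Y)) as [V1 V2].
  assert (HIn : forall i, (i < N)%nat -> X < IZR (up X) + INR i <= X + Y).
  { intros i Hi.
    assert (Hp := pos_INR i). split; [lra|].
    assert (Hz : (up X + Z.of_nat i <= Int_part (X + Y))%Z) by (unfold N in Hi; lia).
    apply IZR_le in Hz. rewrite plus_IZR, <- INR_IZR_INZ in Hz. lra. }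
  assert (HN : INR N <= Y + 1).
  { destruct N as [|M]; [simpl; lra|].
    specialize (HIn M ltac:(lia)). rewrite S_INR. lra. }
  rewrite (exp_sum_esum f s X Y N eq_refl)
    by (intros; symmetry; now apply Hf, HIn).
  destruct d as [|[|k]]; [lia|lia|].
  assert (Hk : (1 <= k)%nat) by lia.
  assert (Hfd : forall n, (n + (k + 2) < N)%nat ->
                lam <= fdiff (k + 2) s n <= Lam).
  { intros n Hn. replace (k + 2)%nat with (S (S k)) in * by lia.
    rewrite <- (Nat.add_0_l n) at 1 2. rewrite <- !fdiff_shift.
    rewrite (fdiff_ext _ _ (fun i => F 0%nat (IZR (up X) + INR n + INR i)))
      by (intros i; unfold s; rewrite plus_INR; f_equal; ring).
    apply (fdiff_mvt _ (fun x => X < x <= X + Y)); trivial.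
    - intros; lra.
    - apply HIn. lia.
    - rewrite Rplus_assoc, <- plus_INR. apply HIn. lia. }
  assert (HB := cB_bounds). assert (HA := cA_pos).
  set (K := (2 ^ k)%nat).
  assert (HD : Dd (S (S k)) = 4 * INR K).
  { unfold Dd, K. rewrite pow_INR. change (INR 2) with 2. simpl. ring. }
  assert (HKpos : (0 < K)%nat) by (unfold K; apply Nat.neq_0_lt_0, Nat.pow_nonzero; lia).
  assert (HK2 : (2 <= K)%nat).
  { unfold K. change 2%nat with (2 ^ 1)%nat at 1. apply Nat.pow_le_mono_r; lia. }
  assert (HK : 2 <= INR K) by now apply (le_INR 2).
  assert (HkR : 1 <= INR (S (S k)) - 2).
  { rewrite !S_INR. assert (1 <= INR k) by now apply (le_INR 1). lra. }
  set (M := Rmax _ _).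
  (* [T1], [T2], [T3] bound the three terms from below after division by B, since d >= 3 makes the
     powers of d - 2 at least 1. *)
  set (T1 := sqrt 2 * Rpower (Lam / (lam * Y)) (2 / Dd (S (S k)))).
  set (T2 := Rpower (3 ^ 4 / 2 ^ 3 * (2 / 3) ^ (2 * (S (S k)))
      * Rpower 2 (Dd (S (S k)) / 4) * cA ^ 2 * / cB ^ 2) (1 / (Dd (S (S k)) - 2))
      * Rpower (Lam ^ 2 / lam) (1 / (Dd (S (S k)) - 2))).
  set (T3 := Rpower (cA * Dd (S (S k)) / cB) (4 / Dd (S (S k)))
      * Rpower (lam * Y ^ (S (S k))) (- (2 / Dd (S (S k))))).
  assert (Hs2 : 0 < sqrt 2) by (apply sqrt_lt_R0; lra).
  assert (Hpow : forall x y, 0 < Rpower x y) by (intros; apply exp_pos).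
  assert (H1 : cB * T1 <= M).
  { eapply Rle_trans; [|apply Rmax_l]. unfold A_d, T1.
    rewrite <- Rmult_assoc. apply Rmult_le_compat_r; [apply Rlt_le, Hpow|].
    rewrite <- (Rmult_1_r (cB * sqrt 2)) at 1.
    apply Rmult_le_compat_l; [apply Rlt_le, Rmult_lt_0_compat; lra|].
    apply Rpower_ge_1; [trivial|]. rewrite HD.
    apply Rdiv_le_0_compat; lra. }
  assert (H2 : cB * T2 <= M).
  { eapply Rle_trans; [|apply Rmax_r]. eapply Rle_trans; [|apply Rmax_l].
    unfold B_d, T2. rewrite <- Rmult_assoc. apply Rle_refl. }
  assert (H3 : cB * T3 <= M).
  { eapply Rle_trans; [|apply Rmax_r]. eapply Rle_trans; [|apply Rmax_r].
    unfold C_d, T3.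
    rewrite <- Rmult_assoc. apply Rmult_le_compat_r; [apply Rlt_le, Hpow|].
    rewrite <- (Rmult_1_r (cB * Rpower _ _)) at 1.
    apply Rmult_le_compat_l.
    { apply Rlt_le, Rmult_lt_0_compat; [lra|apply Hpow]. }
    apply Rpower_ge_1; [trivial|]. rewrite HD.
    apply Rdiv_le_0_compat; lra. }
  assert (HT : forall T, cB * T <= M -> T <= M / cB).
  { intros T H. apply Rmult_le_reg_l with cB; [lra|].
    replace (cB * (M / cB)) with M by (field; lra). trivial. }
  apply HT in H1. apply HT in H2. apply HT in H3.
  assert (HT1 : 0 < T1) by (apply Rmult_lt_0_compat; [trivial|apply Hpow]).
  assert (HT2 : 0 < T2) by (apply Rmult_lt_0_compat; apply Hpow).
  assert (HT3 : 0 < T3) by (apply Rmult_lt_0_compat; apply Hpow).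
  replace M with (cB * (M / cB)) by (field; lra).
  set (G := M / cB) in *.
  assert (HG : 0 < G) by lra.
  clearbody G.
  assert (HlY : 0 < lam * Y) by (apply Rmult_lt_0_compat; lra).
  assert (HGz : forall n, (G ^ K) ^ n = G ^ (K * n)) by (intros; symmetry; apply pow_mult).
  apply (discrete_derivative_test s N k Y lam Lam G); trivial; try lra;
    fold K; rewrite !HGz.
  (* With D = 4 K, the exponent 2 / D is cleared by the power 2 K. *)
  - assert (E : T1 ^ (K * 2) = 2 ^ K * (Lam / (lam * Y))).
    { unfold T1. rewrite Rpow_mult_distr. f_equal.
      - rewrite Nat.mul_comm, pow_mult. f_equal. apply pow2_sqrt; lra.
      - rewrite (Rpower_pow_mul _ _ 1).
        + apply Rpower_1. apply Rdiv_lt_0_compat; lra.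
        + apply Rdiv_lt_0_compat; lra.
        + rewrite HD, mult_INR. simpl (INR 2). field. lra. }
    assert (I := pow_incr T1 G (K * 2) ltac:(lra)). rewrite E in I.
    apply Rmult_le_compat_l with (r := lam * Y) in I; [|lra].
    eapply Rle_trans; [|apply I]. apply Req_le. field. lra.
  (* The power D - 2 clears the root, and d = k + 2 simplifies the constant: 3^4 / 2^3 * (2/3)^4 =
     2. The factor G^2 missing from G^(4 K) is the one on the left of the goal. *)
  - assert (E : T2 ^ (4 * K - 2) =
      2 * ((2 / 3) ^ k) ^ 2 * 2 ^ K * cA ^ 2 / cB ^ 2 * (Lam ^ 2 / lam)).
    { assert (Hc : 1 / (Dd (S (S k)) - 2) * INR (4 * K - 2) = 1).
      { rewrite HD, minus_INR, mult_INR by lia. simpl INR. field. lra. }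
      assert (HLl : 0 < Lam ^ 2 / lam).
      { apply Rdiv_lt_0_compat; [apply pow_lt|]; lra. }
      unfold T2. rewrite Rpow_mult_distr.
      assert (HW : 0 < 3 ^ 4 / 2 ^ 3 * (2 / 3) ^ (2 * S (S k))
        * Rpower 2 (Dd (S (S k)) / 4) * cA ^ 2 * / cB ^ 2).
      { apply Rmult_lt_0_compat; [|apply Rinv_0_lt_compat, pow_lt; lra].
        apply Rmult_lt_0_compat; [|apply pow_lt; lra].
        apply Rmult_lt_0_compat; [|apply Hpow].
        apply Rmult_lt_0_compat; [lra|apply pow_lt; lra]. }
      rewrite !(Rpower_pow_mul _ _ 1), !Rpower_1 by trivial.
      f_equal. rewrite HD. replace (4 * INR K / 4) with (INR K) by field.
      rewrite Rpower_pow by lra.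
      replace (2 * S (S k))%nat with (4 + k * 2)%nat by lia.
      rewrite pow_add, pow_mult. field. lra. }
    assert (I := pow_incr T2 G (4 * K - 2) ltac:(lra)). rewrite E in I.
    replace (K * 4)%nat with (2 + (4 * K - 2))%nat by lia.
    rewrite (pow_add G).
    apply Rmult_le_compat_l with (r := cB ^ 2 * lam * G ^ 2) in I.
    2: { apply Rlt_le; repeat apply Rmult_lt_0_compat; try apply pow_lt; lra. }
    eapply Rle_trans; [|eapply Rle_trans; [apply I|apply Req_le; ring]].
    apply Req_le. change (2 ^ S K) with (2 * 2 ^ K). field. lra.
  - replace (k + 2)%nat with (S (S k)) by lia.
    assert (HlYk : 0 < lam * Y ^ S (S k)).
    { apply Rmult_lt_0_compat; [|apply pow_lt]; lra. }
    assert (HAD : 0 < cA * Dd (S (S k)) / cB).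
    { rewrite HD. apply Rdiv_lt_0_compat; [apply Rmult_lt_0_compat|]; lra. }
    assert (E : T3 ^ (K * 2) =
      (cA * Dd (S (S k)) / cB) ^ 2 * / (lam * Y ^ S (S k))).
    { unfold T3. rewrite Rpow_mult_distr. f_equal.
      - rewrite (Rpower_pow_mul _ _ (INR 2)); trivial; [now apply Rpower_pow|].
        rewrite HD, mult_INR. simpl INR. field. lra.
      - rewrite (Rpower_pow_mul _ _ (Ropp 1)); trivial.
        + rewrite Rpower_Ropp, Rpower_1; trivial.
        + rewrite HD, mult_INR. simpl INR. field. lra. }
    assert (I := pow_incr T3 G (K * 2) ltac:(lra)). rewrite E in I.
    apply Rmult_le_compat_l with (r := cB ^ 2 * (lam * Y ^ S (S k))) in I.
    2: { apply Rlt_le, Rmult_lt_0_compat; [apply pow_lt; lra|trivial]. }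
    eapply Rle_trans; [|apply I]. apply Req_le.
    rewrite HD. unfold K. rewrite pow_INR. change (INR 2) with 2.
    set (w := lam * Y ^ S (S k)) in *. field. split; lra.
Qed.
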